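(* Let $f\colon E\to B$ be a Steenrod fibration between compacta, let $b\in B$ be such that $f^{-1}(b)$ is non-empty, and pick $\tilde b\in f^{-1}(b)$. If $B$ is connected, then the induced map of Steenrod homotopy sets $f_*\colon\pi_0(E,\tilde b)\to\pi_0(B,b)$ is surjective.
   Context: A compactum is a compact metrizable space. Let $P=(\dots\xrightarrow{p_1}P_1\xrightarrow{p_0}P_0)$ and $Q=(\dots\xrightarrow{q_1}Q_1\xrightarrow{q_0}Q_0)$ be inverse sequences of compact polyhedra and PL maps, with composite bonding maps $p^j_i\colon P_j\to P_i$ and $q^j_i\colon Q_j\to Q_i$. A PL level map $w\colon P\to Q$ is a sequence of PL maps $w_i\colon P_i\to Q_i$ with $w_ip_i=q_iw_{i+1}$ for each $i$. It satisfies the homotopy lifting property if for each $i$ there exists a $j>i$ such that, given a compact polyhedron $K$, a homotopy $h_t\colon K\to Q_j$ and a lift $\bar h_0\colon K\to P_j$ of $h_0$ (i.e. $w_j\bar h_0=h_0$), there exists a homotopy $\tilde h_t\colon K\to P_i$ with $w_i\tilde h_t=q^j_ih_t$ and $\tilde h_0=p^j_i\bar h_0$. A map $f\colon E\to B$ between compacta is a Steenrod fibration if $E=\varprojlim P$, $B=\varprojlim Q$ and $f=\varprojlim w$ for some such $P$, $Q$ and $w$ with $w$ satisfying the homotopy lifting property. For a compactum $X=\varprojlim(\dots\to P_1\to P_0)$ ($P_i$ compact polyhedra, PL bonding maps $p_i$), the mapping telescope $P_{[0,\infty)}=MC(p_0)\cup_{P_1}MC(p_1)\cup\dots$ projects to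 $[0,\infty)$ so that $MC(p_i)$ goes onto $[i,i+1]$. The Steenrod homotopy set $\pi_0(X,x)$ is the set of level-preserving maps $[0,\infty)\to P_{[0,\infty)}$ up to level-preserving homotopy, pointed by the telescope of the images of $x$ in the $P_i$; it is independent of the choice of the $P_i$, and for $f=\varprojlim w$ the map $f_*$ is induced by the level-preserving map $P_{[0,\infty)}\to Q_{[0,\infty)}$ determined by the $w_i$. *)

(* Defs.v *)
From HB Require Import structures.
From mathcomp Require Import all_boot all_order all_algebra finmap.
From mathcomp Require Import all_classical all_reals topology normedtype.
From Stdlib Require Import Relation_Operators.

Set Implicit Arguments.
Unset Strict Implicit.
Unset Printing Implicit Defensive.

Import Order.TTheory GRing.Theory Num.Theory.
Import numFieldNormedType.Exports.

Local Open Scope classical_set_scope.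
Local Open Scope ring_scope.
Local Open Scope quotient_scope.

(* Throughout, a set used as a type is the subspace [set_type]. *)

Lemma continuous_to_set_type (S T : topologicalType) (A : set T)
  (f : S -> A) : continuous (fun x => val (f x)) -> continuous f.
Proof.
move=> cf; apply/continuousP => _ [U oU <-].
rewrite -comp_preimage; move/continuousP: cf; exact.
Qed.

Lemma continuous_set_val (T : topologicalType) (A : set T) :
  continuous (val : A -> T).
Proof. exact: initial_continuous. Qed.

Lemma continuous_compose (S T U : topologicalType) (f : S -> T) (g : T -> U) :
  continuous f -> continuous g -> continuous (fun x => g (f x)).
Proof. by move=> cf cg x; apply: continuous_comp; [exact: cf | exact: cg]. Qed.

Lemma continuous_fst (S T : topologicalType) : continuous (@fst S T).
Proof. by move=> x; exact: cvg_fst. Qed.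

Lemma continuous_snd (S T : topologicalType) : continuous (@snd S T).
Proof. by move=> x; exact: cvg_snd. Qed.

Lemma continuous_pair (S T U : topologicalType) (f : S -> T) (g : S -> U) :
  continuous f -> continuous g -> continuous (fun x => (f x, g x)).
Proof. by move=> cf cg x; apply: cvg_pair; [exact: cf | exact: cg]. Qed.

Section Intervals.
Variable R : realType.

Definition segment (a b : R) : set R := [set t | a <= t <= b].

Definition halfline : set R := [set t | 0 <= t].

Definition unitI : set R := segment 0 1.

Definition mk_segment (a b t : R) (h : a <= t <= b) : segment a b :=
  exist _ t (mem_set h).

Lemma segmentP (a b : R) (t : segment a b) : a <= val t <= b.
Proof. exact: (set_mem (valP t)). Qed.

Lemma halflineP (t : halfline) : 0 <= val t.
Proof. exact: (set_mem (valP t)). Qed.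

Definition unitI0 : unitI :=
  mk_segment (introT andP (conj (lexx 0) ler01)).
Definition unitI1 : unitI :=
  mk_segment (introT andP (conj ler01 (lexx 1))).

Lemma clamp_subproof (a b : R) (ab : a <= b) (t : R) :
  a <= Num.max a (Num.min b t) <= b.
Proof. by rewrite le_max lexx /= ge_max ab ge_min lexx. Qed.

Definition clamp (a b : R) (ab : a <= b) (t : R) : segment a b :=
  mk_segment (clamp_subproof ab t).

Lemma clampE (a b : R) (ab : a <= b) (t : R) :
  a <= t <= b -> val (clamp ab t) = t.
Proof. by move=> /andP[at_ tb] /=; rewrite (min_idPr tb) (max_idPr at_). Qed.

Lemma continuous_clamp (a b : R) (ab : a <= b) : continuous (clamp ab).
Proof.
apply: continuous_to_set_type => t /=.
apply: continuous_max; first exact: cst_continuous.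
by apply: continuous_min; [exact: cst_continuous | exact: id].
Qed.

End Intervals.
Arguments halfline : clear implicits.
Arguments unitI : clear implicits.
Arguments unitI0 : clear implicits.
Arguments unitI1 : clear implicits.

Section Polyhedra.
Variable R : realType.

Section Complexes.
Variable n : nat.
Local Notation E := 'rV[R]_n.

Definition conv_hull (s : {fset E}) : set E :=
  [set x | exists c : E -> R, [/\ forall v, v \in s -> 0 <= c v,
     \sum_(v <- s) c v = 1 & x = \sum_(v <- s) c v *: v]].

Definition affinely_independent (s : {fset E}) :=
  forall c : E -> R, \sum_(v <- s) c v = 0 -> \sum_(v <- s) c v *: v = 0 ->
  forall v, v \in s -> c v = 0.

(* A simplex is given by its vertex set.  Since the hull of the empty set is
   empty, the last clause says that two simplices are disjoint or meet in the
   common face spanned by their common vertices. *)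
Definition simplicial_complex (K : {fset {fset E}}) :=
  [/\ forall s, s \in K -> s != fset0 /\ affinely_independent s,
      forall s t : {fset E},
        s \in K -> (t `<=` s)%fset -> t != fset0 -> t \in K
    & forall s t : {fset E}, s \in K -> t \in K ->
        conv_hull s `&` conv_hull t = conv_hull (s `&` t)%fset].

Definition support_of (K : {fset {fset E}}) : set E :=
  [set x | exists2 s, s \in K & conv_hull s x].

Definition triangulates (K : {fset {fset E}}) (A : set E) :=
  simplicial_complex K /\ support_of K = A.

End Complexes.

Record polyhedron := Polyhedron {
  pdim : nat;
  pset :> set 'rV[R]_pdim;
  psetP : exists K, triangulates K pset }.

Definition affine_on (P Q : polyhedron) (C : set 'rV[R]_(pdim P))
    (f : P -> Q) :=
  forall (x y z : P) (t : R), C (val x) -> C (val y) -> 0 <= t <= 1 ->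
    val z = (1 - t) *: val x + t *: val y ->
    val (f z) = (1 - t) *: val (f x) + t *: val (f y).

Definition PL (P Q : polyhedron) (f : P -> Q) :=
  continuous f /\
  exists K, triangulates K P /\
    forall s, s \in K -> affine_on (conv_hull s) f.

Record inv_seq := InvSeq {
  space :> nat -> polyhedron;
  bond : forall i, space i.+1 -> space i;
  bondPL : forall i, PL (@bond i) }.

(* [bonds P k i] is the composite bonding map from level [j = k + i] to
   level [i]. *)
Fixpoint bonds (P : inv_seq) (k i : nat) : P (k + i)%N -> P i :=
  match k return P (k + i)%N -> P i with
  | 0%N => id
  | k'.+1 => fun x => @bonds P k' i (bond x)
  end.
Arguments bonds : clear implicits.

Record level_map (P Q : inv_seq) := LevelMap {
  lmap :> forall i, P i -> Q i;
  lmapPL : forall i, PL (@lmap i);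
  lmap_bond : forall i (x : P i.+1), lmap (bond x) = bond (lmap x) }.
Arguments lmap {P Q} _ i _.

(* The levels [j > i] are written [k.+1 + i]. *)
Definition homotopy_lifting (P Q : inv_seq) (w : level_map P Q) :=
  forall i, exists k, let j := (k.+1 + i)%N in
  forall (K : polyhedron) (h : (K * unitI R)%type -> Q j) (h0 : K -> P j),
    continuous h -> continuous h0 ->
    (forall x, lmap w j (h0 x) = h (x, unitI0 R)) ->
  exists ht : (K * unitI R)%type -> P i,
    [/\ continuous ht,
        forall z, lmap w i (ht z) = bonds Q k.+1 i (h z)
      & forall x, ht (x, unitI0 R) = bonds P k.+1 i (h0 x)].

Definition invlim (P : inv_seq) : set (prod_topology (fun i => P i)) :=
  [set x : forall i, P i | forall i, bond (x i.+1) = x i].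
Arguments invlim : clear implicits.

Definition homeomorphism (S T : topologicalType) (h : S -> T) :=
  continuous h /\
  exists g : T -> S, [/\ continuous g, cancel h g & cancel g h].

Record presentation (X : topologicalType) := Presentation {
  pres_seq :> inv_seq;
  pres_map : X -> invlim pres_seq;
  pres_homeo : homeomorphism pres_map }.

Definition coord (X : topologicalType) (A : presentation X) (i : nat)
  (x : X) : A i := val (pres_map A x) i.

Lemma coord_bond X (A : presentation X) i (x : X) :
  bond (coord A i.+1 x) = coord A i x.
Proof. exact: (set_mem (valP (pres_map A x))). Qed.

(* The data exhibiting [f] as a Steenrod fibration: presentations [E = lim P]
   and [B = lim Q] and a level map [w : P -> Q] with [f = lim w]. *)
Record steenrod_fibration (E B : topologicalType) (f : E -> B) :=
  SteenrodFibration {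
    fib_dom : presentation E;
    fib_cod : presentation B;
    fib_map : level_map fib_dom fib_cod;
    fib_lim : forall i e,
      coord fib_cod i (f e) = lmap fib_map i (coord fib_dom i e);
    fib_hlp : homotopy_lifting fib_map }.

(* The pieces are [P_0 x {0}] and [P_(i+1) x [i, i+1]].  Identifying [(x, i)]
   in the latter with [p_i x] in the copy [P_i x {i}] of [P_i] turns it into the
   mapping cylinder of [p_i], attached along [P_i] to the previous one. *)
Definition piece (P : inv_seq) (i : nat) : topologicalType :=
  (P i * segment (i.-1%:R : R) i%:R)%type.

Definition pretelescope (P : inv_seq) : topologicalType := {i & piece P i}.

Inductive glue (P : inv_seq) : pretelescope P -> pretelescope P -> Prop :=
| Glue i (x : P i.+1) (t : segment i%:R i.+1%:R) (s : segment i.-1%:R i%:R) :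
    val t = i%:R -> val s = i%:R ->
    glue (existT (piece P) i.+1 (x, t)) (existT (piece P) i (bond x, s)).

Definition glued (P : inv_seq) (a b : pretelescope P) : bool :=
  `[< clos_refl_sym_trans _ (@glue P) a b >].

Lemma glued_refl (P : inv_seq) : reflexive (@glued P).
Proof. by move=> a; apply/asboolP; exact: rst_refl. Qed.

Lemma glued_sym (P : inv_seq) : symmetric (@glued P).
Proof.
by move=> a b; apply/asboolP/asboolP => ab; exact: rst_sym.
Qed.

Lemma glued_trans (P : inv_seq) : transitive (@glued P).
Proof.
move=> b a c /asboolP ab /asboolP bc; apply/asboolP.
exact: rst_trans ab bc.
Qed.

Definition glued_equiv (P : inv_seq) : equiv_rel (pretelescope P) :=
  EquivRel (@glued P) (@glued_refl P) (@glued_sym P) (@glued_trans P).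

Definition telescope (P : inv_seq) := {eq_quot (glued_equiv P)}.
HB.instance Definition _ P :=
  Topological.copy (telescope P) (quotient_topology (telescope P)).
HB.instance Definition _ P := Quotient.on (telescope P).

Definition tele (P : inv_seq) (i : nat) (x : P i)
  (t : segment (i.-1%:R : R) i%:R) : telescope P :=
  \pi_(telescope P) (existT (piece P) i (x, t)).

Lemma glue_pi (P : inv_seq) (a b : pretelescope P) :
  glue a b -> \pi_(telescope P) a = \pi_(telescope P) b.
Proof. by move=> ab; apply/eqmodP/asboolP; exact: rst_step. Qed.

Lemma tele_lift (P : inv_seq) (Z : Type) (g : pretelescope P -> Z) :
  (forall a b, glue a b -> g a = g b) ->
  forall a, g (repr (\pi_(telescope P) a)) = g a.
Proof.
move=> gP a; have closP u v : clos_refl_sym_trans _ (@glue P) u v -> g u = g v.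
  by elim=> [{}u {}v /gP|//|{}u {}v _ ->|{}u {}v w _ -> _ ->].
apply/closP/asboolP; apply/(@eqmodP _ (glued_equiv P)).
by rewrite reprK.
Qed.

Lemma tele_lift_continuous (P : inv_seq) (Z : topologicalType)
  (g : pretelescope P -> Z) :
  (forall a b, glue a b -> g a = g b) -> continuous g ->
  continuous (g \o repr : telescope P -> Z).
Proof.
move=> gP cg; apply/quotient_continuous => /=.
suff -> : ((g \o repr : telescope P -> Z) \o \pi_(telescope P)) = g by [].
by apply: funext => a /=; exact: tele_lift.
Qed.

(* [level] is the projection of the telescope to [0, oo). *)
Definition prelevel (P : inv_seq) (a : pretelescope P) : R :=
  val (projT2 a).2.

Definition level (P : inv_seq) (z : telescope P) : R := prelevel (repr z).

Lemma level_pi (P : inv_seq) (a : pretelescope P) :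
  level (\pi_(telescope P) a) = prelevel a.
Proof. by apply: tele_lift => _ _ [i x t s /= ts ss]; rewrite /prelevel /= ts. Qed.

Definition pretele_map (P Q : inv_seq) (w : level_map P Q)
  (a : pretelescope P) : pretelescope Q :=
  existT (piece Q) (projT1 a) (lmap w (projT1 a) (projT2 a).1, (projT2 a).2).

Definition tele_map (P Q : inv_seq) (w : level_map P Q)
  (z : telescope P) : telescope Q :=
  \pi_(telescope Q) (pretele_map w (repr z)).

Lemma pretele_map_glue (P Q : inv_seq) (w : level_map P Q) a b :
  glue a b ->
  \pi_(telescope Q) (pretele_map w a) = \pi_(telescope Q) (pretele_map w b).
Proof.
case=> i x t s ts ss; apply: glue_pi.
by rewrite /pretele_map /= lmap_bond; exact: Glue.
Qed.

Lemma tele_map_pi (P Q : inv_seq) (w : level_map P Q) a :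
  tele_map w (\pi_(telescope P) a) = \pi_(telescope Q) (pretele_map w a).
Proof.
exact: (@tele_lift P _ (fun a => \pi_(telescope Q) (pretele_map w a))
  (@pretele_map_glue P Q w)).
Qed.

Lemma level_tele_map (P Q : inv_seq) (w : level_map P Q) z :
  level (tele_map w z) = level z.
Proof. by rewrite level_pi. Qed.

Lemma pretele_map_continuous (P Q : inv_seq) (w : level_map P Q) :
  continuous (pretele_map w).
Proof.
have c i : continuous (fun u : piece P i =>
    existT (piece Q) i (lmap w i u.1, u.2)).
  move=> u; apply: (@continuous_comp _ _ _
    (fun u : piece P i => (lmap w i u.1, u.2) : piece Q i) (existT (piece Q) i)).
    apply: (@continuous_pair (piece P i) (Q i) _ (fun u => lmap w i u.1) snd).
      move=> v; apply: (@continuous_comp _ _ _ fst (lmap w i)).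
        exact: cvg_fst.
      exact: (lmapPL w i).1.
    by move=> v; exact: cvg_snd.
  exact: existT_continuous.
have := @sigT_continuous nat (piece P) (pretelescope Q) _ c.
set g := (g in continuous g -> _); suff -> : g = pretele_map w by [].
by apply: funext => -[].
Qed.

Lemma tele_map_continuous (P Q : inv_seq) (w : level_map P Q) :
  continuous (tele_map w).
Proof.
apply: (@tele_lift_continuous P _
  (fun a => \pi_(telescope Q) (pretele_map w a))).
  exact: pretele_map_glue.
move=> a; apply: continuous_comp; first exact: pretele_map_continuous.
exact: pi_continuous.
Qed.

Record level_path (P : inv_seq) := LevelPath {
  lpath :> halfline R -> telescope P;
  lpath_cont : continuous lpath;
  lpath_level : forall t, level (lpath t) = val t }.

HB.instance Definition _ P := gen_eqMixin (level_path P).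
HB.instance Definition _ P := gen_choiceMixin (level_path P).

Definition level_homotopic (P : inv_seq) (u v : level_path P) :=
  exists H : (halfline R * unitI R)%type -> telescope P,
    [/\ continuous H, forall z, level (H z) = val z.1,
        forall t, H (t, unitI0 R) = u t & forall t, H (t, unitI1 R) = v t].

Lemma level_homotopic_refl (P : inv_seq) (u : level_path P) :
  level_homotopic u u.
Proof.
exists (fun z => u z.1); split=> //; last by move=> z; exact: lpath_level.
exact: (continuous_compose (@continuous_fst _ _) (@lpath_cont _ u)).
Qed.

Lemma level_homotopic_sym (P : inv_seq) (u v : level_path P) :
  level_homotopic u v -> level_homotopic v u.
Proof.
case=> H [cH lH H0 H1].
have c2 : continuous (fun z : (halfline R * unitI R)%type => val z.2).
  exact: (continuous_compose (@continuous_snd _ _) (@continuous_set_val _ _)).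
exists (fun z => H (z.1, clamp ler01 (1 - val z.2))); split.
- apply: (continuous_compose _ cH).
  apply: continuous_pair; first exact: continuous_fst.
  apply: (continuous_compose _ (@continuous_clamp _ _ _ _)) => z.
  by apply: cvgB; [exact: cvg_cst | exact: c2].
- by move=> z; rewrite lH.
- move=> t; rewrite -H1; congr (H (t, _)); apply: val_inj.
  by rewrite clampE /= subr0 ?ler01 ?lexx.
- move=> t; rewrite -H0; congr (H (t, _)); apply: val_inj.
  by rewrite clampE /= subrr ?ler01 ?lexx.
Qed.

Lemma level_homotopic_trans (P : inv_seq) (v u w : level_path P) :
  level_homotopic u v -> level_homotopic v w -> level_homotopic u w.
Proof.
case=> H [cH lH H0 H1] [G [cG lG G0 G1]].
pose a (z : halfline R * unitI R) := H (z.1, clamp ler01 (2 * val z.2)).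
pose b (z : halfline R * unitI R) := G (z.1, clamp ler01 (2 * val z.2 - 1)).
have c2 : continuous (fun z : (halfline R * unitI R)%type => val z.2).
  exact: (continuous_compose (@continuous_snd _ _) (@continuous_set_val _ _)).
have c3 : continuous (fun z : (halfline R * unitI R)%type => 2 * val z.2).
  by move=> z; apply: cvgM; [exact: cvg_cst | exact: c2].
have ck (k : R) : continuous (fun z : (halfline R * unitI R)%type =>
    (z.1, clamp ler01 (2 * val z.2 - k))).
  apply: continuous_pair; first exact: continuous_fst.
  apply: (continuous_compose _ (@continuous_clamp _ _ _ _)) => z.
  by apply: cvgB; [exact: c3 | exact: cvg_cst].
have ca : continuous a.
  apply: (continuous_compose _ cH).
  by have := ck 0; under eq_fun do rewrite subr0; exact.
have cb : continuous b by exact: (continuous_compose (ck 1) cG).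
pose F z := if 2 * val z.2 <= 1 then a z else b z.
have ab z : 2 * val z.2 = 1 -> a z = b z.
  move=> z1; rewrite /a /b z1 subrr.
  have -> : clamp ler01 1 = unitI1 R.
    by apply: val_inj; rewrite clampE ?ler01 ?lexx.
  have -> : clamp ler01 0 = unitI0 R.
    by apply: val_inj; rewrite clampE ?ler01 ?lexx.
  by rewrite H1 G0.
have aF z : 2 * val z.2 <= 1 -> a z = F z by rewrite /F => ->.
have bF z : 1 <= 2 * val z.2 -> b z = F z.
  rewrite /F => z1; case: ifPn => // z2; rewrite ab //.
  by apply/eqP; rewrite eq_le z2 z1.
exists F; split.
- pose A := [set z : (halfline R * unitI R)%type | 2 * val z.2 <= 1].
  pose B := [set z : (halfline R * unitI R)%type | 1 <= 2 * val z.2].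
  have cA : closed A.
    by have /(preimage_closed (in1W c3)) := @closed_le R 1.
  have cB : closed B.
    by have /(preimage_closed (in1W c3)) := @closed_ge R 1.
  have AB : A `|` B = setT.
    apply/seteqP; split=> // z _; rewrite /A /B /=.
    by have [?|/ltW ?] := leP (2 * val z.2) 1; [left | right].
  apply/continuous_subspace_setT; rewrite -AB; apply: withinU_continuous => //.
    apply: (@subspace_eq_continuous _ _ _ a); last exact: continuous_subspaceT.
    by move=> z /set_mem; exact: aF.
  apply: (@subspace_eq_continuous _ _ _ b); last exact: continuous_subspaceT.
  by move=> z /set_mem; exact: bF.
- by move=> z; rewrite /F /a /b; case: ifP => _; rewrite ?lH ?lG.
- move=> t; rewrite /F /= mulr0 ler01 /a /= mulr0 -H0; congr (H (t, _)).
  by apply: val_inj; rewrite clampE ?ler01 ?lexx.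
- move=> t; rewrite /F /= mulr1 leNgt ltr1n /= /b /= mulr1 -G1.
  have -> : (2 - 1 : R) = 1 by rewrite -[2]/(1 + 1) addrK.
  by congr (G (t, _)); apply: val_inj; rewrite clampE ?ler01 ?lexx.
Qed.

Lemma level_homotopicb_refl (P : inv_seq) :
  reflexive (fun u v : level_path P => `[< level_homotopic u v >]).
Proof. by move=> u; apply/asboolP; exact: level_homotopic_refl. Qed.

Lemma level_homotopicb_sym (P : inv_seq) :
  symmetric (fun u v : level_path P => `[< level_homotopic u v >]).
Proof. by move=> u v; apply/asboolP/asboolP; exact: level_homotopic_sym. Qed.

Lemma level_homotopicb_trans (P : inv_seq) :
  transitive (fun u v : level_path P => `[< level_homotopic u v >]).
Proof.
move=> v u w /asboolP uv /asboolP vw; apply/asboolP.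
exact: level_homotopic_trans uv vw.
Qed.

Definition homotopy_equiv (P : inv_seq) : equiv_rel (level_path P) :=
  EquivRel (fun u v : level_path P => `[< level_homotopic u v >])
    (@level_homotopicb_refl P) (@level_homotopicb_sym P)
    (@level_homotopicb_trans P).

Section Basepoint.
Variables (P : inv_seq) (x : forall i, P i).
Hypothesis xP : forall i, bond (x i.+1) = x i.

Lemma pred_natr_le (i : nat) : i.-1%:R <= i%:R :> R.
Proof. by rewrite ler_nat leq_pred. Qed.

Definition thread_piece (i : nat) (t : R) : telescope P :=
  tele (x i) (clamp (pred_natr_le i) t).

Lemma thread_piece_lt (i j : nat) (t : R) : (i < j)%N ->
  t <= i%:R -> j.-1%:R <= t -> thread_piece i t = thread_piece j t.
Proof.
case: j => // j; rewrite ltnS /= => ij ti jt.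
have ji : (j <= i)%N by rewrite -(ler_nat R); exact: le_trans jt ti.
have {ij ji}ij : j = i by apply/eqP; rewrite eqn_leq ji ij.
rewrite {}ij in jt *; have ti' : t = i%:R by apply/eqP; rewrite eq_le ti jt.
rewrite /thread_piece /tele -(xP i); apply/esym/glue_pi/Glue.
  by rewrite clampE // ti' lexx ler_nat leqnSn.
by rewrite clampE // ti' lexx ler_nat leq_pred.
Qed.

Lemma thread_piece_eq (i j : nat) (t : R) :
  i.-1%:R <= t <= i%:R -> j.-1%:R <= t <= j%:R ->
  thread_piece i t = thread_piece j t.
Proof.
move=> /andP[it ti] /andP[jt tj]; have [ij|ji|-> //] := ltngtP i j.
  exact: thread_piece_lt.
by apply/esym; exact: thread_piece_lt.
Qed.

Lemma thread_piece_continuous i : continuous (thread_piece i).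
Proof.
have c : continuous (fun t : R => (x i, clamp (pred_natr_le i) t) : piece P i).
  by apply: continuous_pair; [exact: cst_continuous | exact: continuous_clamp].
have cp : continuous (\pi_(telescope P) : pretelescope P -> telescope P).
  exact: pi_continuous.
exact: (continuous_compose c
  (continuous_compose (@existT_continuous _ (piece P) i) cp)).
Qed.

Definition thread_fun (t : R) : telescope P :=
  let s : R := Num.max 0 t in thread_piece (absz (Num.ceil s)) s.

Lemma ceil_bounds (t : R) : 0 <= t ->
  (absz (Num.ceil t)).-1%:R <= t <= (absz (Num.ceil t))%:R.
Proof.
move=> t0; have c0 : 0 <= Num.ceil t by rewrite ceil_ge0 (lt_le_trans _ t0) ?ltrN10.
have := ceil_itv t; case: (Num.ceil t) c0 => // n _.
case/andP=> nt tn; apply/andP; split; last exact: tn.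
case: n nt {tn} => [|n] nt /=; first exact: t0.
apply: ltW; have <- : (n.+1%:Z - 1)%:~R = n%:R :> R by rewrite intrB -natrB ?subn1.
exact: nt.
Qed.

Lemma thread_funE (i : nat) (t : R) : i.-1%:R <= t <= i%:R ->
  thread_fun t = thread_piece i t.
Proof.
move=> ti; have t0 : 0 <= t by case/andP: ti => it _; exact: le_trans it.
by rewrite /thread_fun (max_idPr t0); apply: thread_piece_eq => //; exact: ceil_bounds.
Qed.

Lemma thread_fun_le0 (t : R) : t <= 0 -> thread_fun t = thread_piece 0 t.
Proof.
move=> t0; rewrite /thread_fun /= (max_idPl t0).
rewrite -(@thread_piece_eq 0 (absz (Num.ceil (0 : R))) 0); last 2 first.
- by rewrite lexx.
- exact: ceil_bounds.
congr tele; apply: val_inj; apply/eqP; rewrite eq_le.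
have /andP[a1 a2] := segmentP (clamp (pred_natr_le 0) t).
have /andP[b1 b2] := segmentP (clamp (pred_natr_le 0) 0).
by rewrite (le_trans a2 b1) (le_trans b2 a1).
Qed.

Lemma thread_fun_continuous : continuous thread_fun.
Proof.
have c N : {within [set t | t <= N%:R], continuous thread_fun}.
  elim: N => [|N IH].
    apply: (@subspace_eq_continuous _ _ _ (thread_piece 0)).
      by move=> t /set_mem t0; apply/esym; exact: thread_fun_le0.
    exact/continuous_subspaceT/thread_piece_continuous.
  have -> : [set t : R | t <= N.+1%:R] =
      [set t | t <= N%:R] `|` [set t | N%:R <= t <= N.+1%:R].
    apply/seteqP; split=> t /=.
      by move=> tN; have [?|/ltW Nt] := leP t N%:R; [left | right; rewrite Nt].
    by case=> [tN|/andP[]//]; apply: le_trans tN _; rewrite ler_nat.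
  apply: withinU_continuous; [exact: (@closed_le R N%:R) | | exact: IH | ].
    have -> : [set t : R | N%:R <= t <= N.+1%:R] =
        [set t | N%:R <= t] `&` [set t | t <= N.+1%:R].
      by apply/seteqP; split=> t /= /andP.
    apply: closedI; first exact: (@closed_ge R N%:R).
    exact: (@closed_le R N.+1%:R).
  apply: (@subspace_eq_continuous _ _ _ (thread_piece N.+1)).
    by move=> t /set_mem tN; apply/esym; exact: (@thread_funE N.+1).
  exact/continuous_subspaceT/thread_piece_continuous.
move=> t.
have sub : [set s : R | s < (Num.bound `|t|)%:R] `<=` [set s | s <= (Num.bound `|t|)%:R].
  by move=> s /= /ltW.
have := continuous_subspaceW sub (c (Num.bound `|t|)).
rewrite (continuous_open_subspace _ (@open_lt R (Num.bound `|t|)%:R)).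
apply; apply: mem_set => /=.
exact: le_lt_trans (ler_norm t) (archi_boundP (normr_ge0 t)).
Qed.

Lemma level_thread (t : halfline R) : level (thread_fun (val t)) = val t.
Proof.
rewrite (thread_funE (ceil_bounds (halflineP t))) /thread_piece level_pi.
exact: (clampE _ (ceil_bounds (halflineP t))).
Qed.

Definition thread_path : level_path P :=
  LevelPath (continuous_compose (@continuous_set_val _ (halfline R))
    thread_fun_continuous) level_thread.

End Basepoint.

(* The point [x] only determines the base point, which is [point]. *)
Definition pi0 (X : topologicalType) (A : presentation X) (x : X) : Type :=
  {eq_quot (homotopy_equiv A)}.
HB.instance Definition _ X (A : presentation X) x := Choice.on (pi0 A x).
HB.instance Definition _ X (A : presentation X) x := Quotient.on (pi0 A x).

Definition base_path (X : topologicalType) (A : presentation X) (x : X) :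
  level_path A := thread_path (fun i => coord_bond A i x).

HB.instance Definition _ X (A : presentation X) x :=
  isPointed.Build (pi0 A x) (\pi_(pi0 A x) (base_path A x)).

Definition path_map (P Q : inv_seq) (w : level_map P Q) (u : level_path P) :
  level_path Q :=
  LevelPath (continuous_compose (@lpath_cont _ u) (@tele_map_continuous _ _ w))
    (fun t => etrans (level_tele_map w (u t)) (lpath_level u t)).

(* This map is pointed when [w] induces [f] and [y = f x], see
   [pi0_map_point]. *)
Definition pi0_map (X Y : topologicalType) (A : presentation X)
  (B : presentation Y) (w : level_map A B) (x : X) (y : Y) (c : pi0 A x) :
  pi0 B y := \pi_(pi0 B y) (path_map w (repr c)).
Arguments pi0_map {X Y A B} w x y c.

Lemma pi0_map_pi (X Y : topologicalType) (A : presentation X)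
  (B : presentation Y) (w : level_map A B) (x : X) (y : Y) (u : level_path A) :
  pi0_map w x y (\pi_(pi0 A x) u) = \pi_(pi0 B y) (path_map w u).
Proof.
apply/(@eqmodP _ (homotopy_equiv B))/asboolP.
have /(@eqmodP _ (homotopy_equiv A))/asboolP[H [cH lH H0 H1]] :
  \pi_(pi0 A x) (repr (\pi_(pi0 A x) u)) = \pi_(pi0 A x) u by rewrite reprK.
exists (fun z => tele_map w (H z)); split.
- exact: (continuous_compose cH (@tele_map_continuous _ _ w)).
- by move=> z; rewrite level_tele_map lH.
- by move=> t; rewrite H0.
- by move=> t; rewrite H1.
Qed.

Lemma pi0_map_point (X Y : topologicalType) (f : X -> Y) (A : presentation X)
  (B : presentation Y) (w : level_map A B)
  (wf : forall i x, coord B i (f x) = lmap w i (coord A i x)) (x : X) :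
  pi0_map w x (f x) point = point.
Proof.
rewrite pi0_map_pi; congr (\pi_(pi0 B (f x)) _).
have lpE (u v : level_path B) : lpath u = lpath v -> u = v.
  case: u v => [u cu lu] [v cv lv] /= uv; subst v.
  by congr LevelPath; exact: Prop_irrelevance.
apply: lpE; apply: funext => t /=.
rewrite /thread_fun /thread_piece /tele tele_map_pi; congr \pi.
exact: (congr1 (fun y => existT (piece B) _ (y, _)) (esym (wf _ x))).
Qed.

End Polyhedra.
Arguments pi0_map {R X Y A B} w x y c.

(* Main.v *)
Require Import Defs.
From mathcomp Require Import all_boot all_order all_algebra finmap.
From mathcomp Require Import all_classical all_reals topology normedtype.
From mathcomp Require Import lra ring.

(* Up to level-preserving homotopy, a level path [v] of the telescope of [Q] is
   the same as the traces [c_k : (k - 1, oo) -> Q_k] of its push-forwards, which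
   the bonding maps carry to one another; time may be shifted in them freely.
   To lift [v], it suffices to find points [x_k] of [P_k], paths [d_k] from
   [w_k x_k] to the trace [c_k] and, for every [k], a path in [P_k] from [x_k] to
   [p_k x_(k+1)] together with a square in [Q_k] that it bounds with [d_k], the
   trace and [q_k d_(k+1)].  That is, one needs a thread in the inverse sequence
   of the sets [S_k] of path components of the homotopy fibres of [w_k] over the
   trace.
   If [B] is connected, [S_k] is nonempty: [c_k] lies in the path component of
   the image of [b], since otherwise, by compactness, [B] would have a point
   whose images lie in the components of the [c_k], and [B] would be disconnected
   by the (clopen) components of a [Q_k].  By homotopy lifting for a one-point
   polyhedron, each [S_k] receives from some [S_j], [j > k], a map factoring
   through the path components of a strict fibre of [w_k].  A fibre of a PL map
   meets every simplex in a convex set, so this map has finite image, and the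
   limit of the [S_k] is nonempty; the thread is read off an ultrafilter on
   [nat]. *)

Set Implicit Arguments.
Unset Strict Implicit.
Unset Printing Implicit Defensive.

Import Order.TTheory GRing.Theory Num.Theory.
Import numFieldNormedType.Exports.

Local Open Scope classical_set_scope.
Local Open Scope ring_scope.
Local Open Scope quotient_scope.

(** * Compact subspaces and pasting along closed sets *)

Lemma compact_set_type (T : topologicalType) (A : set T) :
  compact A -> compact [set: A].
Proof.
move=> cA; have [[x Ax]|A0] := pselect (A !=set0); last first.
  have -> : [set: A] = set0 :> set A.
    rewrite -subset0 => x _; apply: A0.
    by exists (val x); exact: (set_mem (valP x)).
  exact: compact0.
pose x0 : A := exist _ x (mem_set Ax).
(* A retraction onto [A] with the junk value [x0] elsewhere; it only has to be continuous within
   [A]. *)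
pose g (y : T) : A := if pselect (A y) is left Ay then exist _ y (mem_set Ay)
  else x0.
have gE (y : A) : g (val y) = y.
  rewrite /g; case: pselect => [Ay|]; first exact: val_inj.
  by case; exact: (set_mem (valP y)).
have cg : {within A, continuous g}.
  apply/subspace_sigL_continuousP.
  apply: continuous_to_set_type => y.
  have -> : (fun x : A => val (sigL A g x)) = val.
    by apply: funext => z; rewrite /sigL /= gE.
  exact: continuous_set_val.
have -> : [set: A] = g @` A.
  apply/seteqP; split=> // y _; exists (val y); last exact: gE.
  exact: (set_mem (valP y)).
exact: continuous_compact cg cA.
Qed.

Lemma continuous_if_le (R : realType) (Z X : topologicalType) (l : Z -> R)
    (c : R) (f g : Z -> X) : continuous l -> continuous f -> continuous g ->
  (forall z, l z = c -> f z = g z) ->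
  continuous (fun z => if l z <= c then f z else g z).
Proof.
move=> cl cf cg fg.
pose F z := if l z <= c then f z else g z.
have FA z : l z <= c -> f z = F z by rewrite /F => ->.
have FB z : c <= l z -> g z = F z.
  rewrite /F => cz; case: ifPn => // zc.
  by rewrite fg //; apply/eqP; rewrite eq_le zc.
rewrite -/F.
pose A := [set z | l z <= c]; pose B := [set z | c <= l z].
have cA : closed A by exact: (preimage_closed (in1W cl) (@closed_le R c)).
have cB : closed B by exact: (preimage_closed (in1W cl) (@closed_ge R c)).
have AB : A `|` B = setT.
  apply/seteqP; split=> // z _; rewrite /A /B /=.
  by have [?|/ltW ?] := leP (l z) c; [left | right].
apply/continuous_subspace_setT; rewrite -AB; apply: withinU_continuous => //.
  apply: (@subspace_eq_continuous _ _ _ f); last exact: continuous_subspaceT.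
  by move=> z /set_mem; exact: FA.
apply: (@subspace_eq_continuous _ _ _ g); last exact: continuous_subspaceT.
by move=> z /set_mem; exact: FB.
Qed.

(** * Gluing maps over the intervals [m - 1, m] *)

Section NatPieces.
Variable R : realType.
Implicit Types t : R.

(** For [t >= 0] the index is 0 only at time 0, in keeping with the degenerate time interval of
    [piece P 0], and it is [m > 0] exactly when [m - 1 < t <= m]. *)
Definition piece_index t : nat := absz (Num.ceil t).

Lemma piece_index_itv t : 0 <= t ->
  (piece_index t)%:R - 1 < t <= (piece_index t)%:R.
Proof.
move=> t0; have c0 : 0 <= Num.ceil t by rewrite ceil_ge0 (lt_le_trans _ t0)
  ?ltrN10.
have := ceil_itv t; rewrite /piece_index; case: (Num.ceil t) c0 => // n _.
by rewrite intrB.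
Qed.

Lemma leq_of_natr_bounds (m n : nat) t : m%:R - 1 < t -> t <= n%:R -> (m <=
  n)%N.
Proof.
move=> mt tn; rewrite -ltnS -(ltr_nat R) -(natr1 n); lra.
Qed.

Lemma piece_index_eq (m : nat) t : 0 <= t -> m%:R - 1 < t <= m%:R ->
  piece_index t = m.
Proof.
move=> t0 /andP[mt tm]; have /andP[it ti] := piece_index_itv t0.
by apply/eqP; rewrite eqn_leq (leq_of_natr_bounds it tm) (leq_of_natr_bounds mt
  ti).
Qed.

(** The one exception is the lower end of a closed interval, a joint that the ceiling assigns to the
    previous piece. *)
Lemma piece_index_near (m : nat) t : 0 <= t -> m.-1%:R <= t <= m%:R ->
  piece_index t = m \/ exists n, [/\ m = n.+1, t = n%:R & piece_index t = n].
Proof.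
move=> t0 /andP[mt tm]; have [tE|] := boolP ((m == 0)%N || (m.-1%:R < t)).
  left; apply: piece_index_eq => //; rewrite tm andbT.
  case/orP: tE => [/eqP ->|]; first lra.
  by case: m mt {tm} => [|n] /=; rewrite -?(natr1 n); lra.
case: m mt tm => // n /= nt _; rewrite -leNgt => tn; right; exists n.
have {nt tn}-> : t = n%:R by lra.
by split => //; apply: piece_index_eq => //; lra.
Qed.

Variables (Z X : topologicalType) (l : Z -> R) (f : nat -> Z -> X).
Hypothesis l_ge0 : forall z, 0 <= l z.
Hypothesis l_cont : continuous l.
Hypothesis f_cont : forall m, continuous (f m).
Hypothesis f_compat : forall m z, l z = m%:R -> f m z = f m.+1 z.

Definition glue_pieces (z : Z) : X := f (piece_index (l z)) z.

Lemma glue_piecesE (m : nat) (z : Z) :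
  m.-1%:R <= l z <= m%:R -> glue_pieces z = f m z.
Proof.
move=> mz; rewrite /glue_pieces.
have [->//|[n [-> zn ->]]] := piece_index_near (l_ge0 z) mz.
exact: f_compat.
Qed.

Lemma continuous_glue_pieces : continuous glue_pieces.
Proof.
(* [h N] pastes the pieces up to [N] one after another. It agrees with the glued map where
   [l z <= N], hence near every point with [l z < N]. *)
pose h := fix h N z := if N is n.+1 then if l z <= n%:R then h n z else f n.+1 z
                       else f 0%N z.
have hE N z : l z <= N%:R -> h N z = glue_pieces z.
  elim: N => [|N IH] zN /=; first by rewrite (@glue_piecesE 0%N) // zN l_ge0.
  by case: leP => Nz; [exact: IH | rewrite (@glue_piecesE N.+1) // zN ltW].
have ch N : continuous (h N).
  elim: N => [|N IH]; first exact: f_cont.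
  apply: continuous_if_le => // z zN; apply: etrans (hE N z _) _.
    by rewrite zN.
  by rewrite (@glue_piecesE N.+1) // zN lexx ler_nat leqnSn.
move=> z; pose N := (piece_index (l z)).+1.
have zN : l z < N%:R by have := piece_index_itv (l_ge0 z); rewrite -natr1; lra.
have : \forall y \near z, h N y = glue_pieces y.
  have : \forall y \near z, l y < N%:R by exact: (cvgr_lt _ (@l_cont z) _ zN).
  by apply: filterS => y /ltW /hE.
move=> near; rewrite /continuous_at -(hE N z (ltW zN)).
exact: (cvg_trans (near_eq_cvg near) (ch N z)).
Qed.

End NatPieces.

(** * Compactness, segments and path components in polyhedra *)

Section PolyhedronTopology.
Variable R : realType.

Lemma continuous_scale (T : topologicalType) (V : normedModType R)
    (a : T -> R) (f : T -> V) :
  continuous a -> continuous f -> continuous (fun t => a t *: f t).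
Proof. by move=> ca cf t; apply: cvgZ; [exact: ca | exact: cf]. Qed.

Lemma conv_hull_convex n (s : {fset 'rV[R]_n}) (x y : 'rV[R]_n) (t : R) :
  conv_hull s x -> conv_hull s y -> 0 <= t <= 1 ->
  conv_hull s ((1 - t) *: x + t *: y).
Proof.
move=> [c [c0 c1 ->]] [d [d0 d1 ->]] /andP[t0 t1].
exists (fun v => (1 - t) * c v + t * d v); split.
- by move=> v vs; rewrite addr_ge0 ?mulr_ge0 ?c0 ?d0 ?subr_ge0.
- by rewrite big_split /= -!mulr_sumr c1 d1; ring.
- rewrite !scaler_sumr -big_split /=; apply: eq_bigr => v _.
  by rewrite !scalerA -scalerDl.
Qed.

(** The hull is a continuous image of the standard simplex, which is closed in a cube. *)
Lemma conv_hull_compact n (s : {fset 'rV[R]_n}) : compact (conv_hull s).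
Proof.
pose r : seq 'rV[R]_n := enum_fset s; pose m := size r.
pose A := [set w : 'rV[R]_m | forall i, `[0, 1]%classic (w ord0 i)].
pose B := [set w : 'rV[R]_m | \sum_(i < m) w ord0 i = 1].
pose g (w : 'rV[R]_m) := \sum_(i < m) w ord0 i *: r`_i.
have cg : continuous g.
  apply: (continuous_big (@add_continuous _)) => i _.
  by apply: continuous_scale; [exact: coord_continuous | exact: cst_continuous].
have clB : closed B.
  have cs : continuous (fun w : 'rV[R]_m => \sum_(i < m) w ord0 i).
    apply: (continuous_big (@add_continuous _)) => i _.
    exact: coord_continuous.
  exact: (preimage_closed (in1W cs) (@closed_eq R 1)).
have cA : compact A.
  exact: (@rV_compact R m (fun=> `[0, 1]%classic) (fun=> @segment_compact R 0
    1)).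
suff -> : conv_hull s = g @` (A `&` B).
  apply: continuous_compact (compact_closedI cA clB).
  exact: continuous_subspaceT.
apply/seteqP; split=> [x [c [c0 c1 ->]]|_ [w [wA wB] <-]].
  have cr i : (i < m)%N -> 0 <= c r`_i by move=> im; apply: c0; exact: mem_nth.
  have sc1 : \sum_(i < m) c r`_i = 1 by rewrite -c1 (big_nth 0) big_mkord.
  exists (\row_i c r`_i).
    split=> [i|]; last by rewrite /B /= -sc1; apply: eq_bigr => i _;
      rewrite mxE.
    rewrite /= mxE in_itv /= cr //= -sc1 (bigD1 i) //= lerDl.
    by apply: sumr_ge0 => j _; exact: cr.
  by rewrite (big_nth 0) big_mkord; apply: eq_bigr => i _; rewrite mxE.
(* Reads the weights by vertex instead of by index, with the value 0 off [s]. *)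
pose c v := if insub (index v r) is Some i then w ord0 i else 0 : R.
have cE (i : 'I_m) : c r`_i = w ord0 i.
  by rewrite /c index_uniq ?fset_uniq // valK.
exists c; split.
- move=> v _; rewrite /c; case: insubP => // i _ _.
  by have := wA i; rewrite /= in_itv => /andP[].
- rewrite (big_nth 0) big_mkord -wB; apply: eq_bigr => i _; exact: cE.
- by rewrite (big_nth 0) big_mkord; apply: eq_bigr => i _; rewrite -cE.
Qed.

Lemma support_compact n (K : {fset {fset 'rV[R]_n}}) : compact (support_of K).
Proof.
have -> : support_of K = \big[setU/set0]_(s <- enum_fset K) conv_hull s.
  rewrite -bigcup_seq; apply/seteqP.
  by split=> x [s sK xs]; exists s.
by apply: bigsetU_compact => s _; exact: conv_hull_compact.
Qed.

Lemma polyhedron_compact (P : polyhedron R) : compact [set: P].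
Proof.
apply: compact_set_type; have [K [_ <-]] := psetP P; exact: support_compact.
Qed.

Lemma simplex_segment (P : polyhedron R) (K : {fset {fset 'rV[R]_(pdim P)}})
    (s : {fset 'rV[R]_(pdim P)}) (x y : P) :
  triangulates K P -> s \in K -> conv_hull s (val x) -> conv_hull s (val y) ->
  exists d : R -> P, [/\ continuous d, forall t, conv_hull s (val (d t))
    & forall t, 0 <= t <= 1 -> val (d t) = (1 - t) *: val x + t *: val y].
Proof.
move=> [_ KP] sK sx sy; pose u (t : R) : R := val (clamp ler01 t).
have su t : conv_hull s ((1 - u t) *: val x + u t *: val y).
  by apply: conv_hull_convex => //; exact: segmentP.
have Pu t : @pset _ P ((1 - u t) *: val x + u t *: val y) 
  by have /seteqP[KsP _] := KP; apply: KsP; exists s.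
exists (fun t => exist (fun z => z \in @pset _ P) _ (mem_set (Pu t)));
  split=> //; last first.
  by move=> t t01; rewrite /= /u clampE.
have cu : continuous u.
  exact: (continuous_compose (@continuous_clamp _ _ _ _) (@continuous_set_val _
    _)).
apply: continuous_to_set_type => t /=.
apply: (@cvgD _ _ _ _ _ (fun t => (1 - u t) *: val x) (fun t => u t *: val y)).
  apply: (continuous_scale (a := fun t => 1 - u t)); last exact: cst_continuous.
  by move=> z; apply: cvgB; [exact: cvg_cst | exact: cu].
by apply: (continuous_scale (a := u)); [exact: cu | exact: cst_continuous].
Qed.

(** Paths are parametrised by all of [R]; clamping the parameter shows that this is the usual
    relation of lying in one path component. *)
Definition joined (X : topologicalType) (x y : X) :=
  exists d : R -> X, [/\ continuous d, d 0 = x & d 1 = y].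

Lemma joined_refl (X : topologicalType) (x : X) : joined x x.
Proof. by exists (fun=> x); split=> //; exact: cst_continuous. Qed.

Lemma continuous_affine (a b : R) : continuous (fun t : R => a * t + b).
Proof.
move=> t; apply: cvgD; last exact: cvg_cst.
by apply: cvgM; [exact: cvg_cst | exact: cvg_id].
Qed.

Lemma joined_sym (X : topologicalType) (x y : X) : joined x y -> joined y x.
Proof.
move=> [d [cd d0 d1]]; exists (fun t => d (-1 * t + 1)); split.
- exact: continuous_compose (@continuous_affine _ _) cd.
- by rewrite mulr0 add0r.
- by rewrite mulr1 addNr.
Qed.

Lemma joined_trans (X : topologicalType) (y x z : X) :
  joined x y -> joined y z -> joined x z.
Proof.
move=> [d [cd d0 d1]] [e [ce e0 e1]].
exists (fun t => if t <= 2^-1 then d (2 * t + 0) else e (2 * t + -1)); split.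
- apply: (continuous_if_le (l := id)).
  + by move=> t; exact: cvg_id.
  + exact: continuous_compose (@continuous_affine _ _) cd.
  + exact: continuous_compose (@continuous_affine _ _) ce.
  + move=> t ->; have -> : 2 * 2^-1 = 1 :> R by lra.
    by rewrite addr0 subrr d1 e0.
- by rewrite ifT ?mulr0 ?addr0 //; lra.
- rewrite ifF; last lra.
  by have -> : 2 * 1 + -1 = 1 :> R by ring.
Qed.

Lemma joined_map (X Y : topologicalType) (f : X -> Y) (x y : X) :
  continuous f -> joined x y -> joined (f x) (f y).
Proof.
move=> cf [d [cd <- <-]]; exists (fun t => f (d t)); split=> //.
exact: continuous_compose cd cf.
Qed.

(* A union of path components of a polyhedron is a union of closed simplices. *)
Lemma joined_closed (P : polyhedron R) (D : set P) :
  (forall x y, D x -> joined x y -> D y) -> closed D.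
Proof.
move=> DP; have [K KP] := psetP P.
pose F s : set P := if `[< exists2 x, D x & conv_hull s (val x) >]
  then val @^-1` (conv_hull s) else set0.
have -> : D = \big[setU/set0]_(s <- enum_fset K) F s.
  rewrite -bigcup_seq; apply/seteqP; split=> [x Dx|x [s /= sK]].
    have [s sK sx] : support_of K (val x).
      by case: KP => _ ->; exact: (set_mem (valP x)).
    exists s => //; rewrite /F; case: asboolP => // n; exfalso; apply: n.
    by exists x.
  rewrite /F; case: asboolP => // -[y Dy sy] sx; apply: DP Dy _.
  have [d [cd _ dE]] := simplex_segment KP sK sy sx.
  exists d; split=> //; apply: val_inj; rewrite dE ?lexx ?ler01 //.
    by rewrite subr0 scale1r scale0r addr0.
  by rewrite subrr scale1r scale0r add0r.
apply: closed_bigsetU => s _; rewrite /F; case: asboolP => _;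
  last exact: closed0.
apply: (preimage_closed (in1W (@continuous_set_val _ (@pset _ P)))).
by apply: compact_closed; [exact: norm_hausdorff | exact: conv_hull_compact].
Qed.

(** A point, realised in dimension 0, is the parameter space that turns homotopy lifting into path
    lifting. *)
Lemma point_complex :
  triangulates [fset [fset (0 : 'rV[R]_0)]]%fset [set: 'rV[R]_0].
Proof.
have hull : conv_hull [fset (0 : 'rV[R]_0)]%fset = setT.
  apply/seteqP; split=> // x _; exists (fun=> 1); split.
  - by move=> *; exact: ler01.
  - by rewrite big_seq_fset1.
  - by rewrite [RHS]thinmx0 [LHS]thinmx0.
split; last first.
  apply/seteqP; split=> // x _; exists [fset 0]%fset; first by rewrite inE.
  by rewrite hull.
split.
- move=> s; rewrite inE => /eqP ->; split.
    by apply/eqP => /fsetP/(_ 0); rewrite !inE eqxx.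
  by move=> c; rewrite big_seq_fset1 => c0 _ v; rewrite inE => /eqP ->.
- by move=> s t; rewrite !inE => /eqP ->; rewrite fsubset1 => /orP[//|->].
- by move=> s t; rewrite !inE => /eqP -> /eqP ->; rewrite fsetIid setIid.
Qed.

Definition point_polyhedron : polyhedron R :=
  Polyhedron (ex_intro (fun K => triangulates K _) _ point_complex).

End PolyhedronTopology.

(** * Topology of the mapping telescope *)

Section TelescopeTopology.
Variables (R : realType) (P : inv_seq R) (x0 : forall k, P k).

(* The composite bonding map [P j -> P k]; the junk value [x0] when [j < k]. *)
Fixpoint descend (k j : nat) {struct j} : P j -> P k :=
  if pselect (j = k) is left e then fun x => ecast i (P i) e x else
  match j return P j -> P k with
  | 0%N => fun=> x0 k
  | j'.+1 => fun x => descend k (bond x)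
  end.

Lemma descend_id k (x : P k) : descend k x = x.
Proof.
case: k x => [|k] x /=; case: pselect => // e;
  by rewrite (Prop_irrelevance e erefl).
Qed.

Lemma descendS k j (x : P j.+1) : (k <= j)%N -> descend k x = descend k (bond
  x).
Proof. by move=> kj /=; case: pselect => // e; rewrite -e ltnn in kj. Qed.

Lemma bond_descend k j (x : P j) : (k < j)%N -> bond (descend k.+1 x) = descend
  k x.
Proof.
elim: j x => // j IH x; rewrite ltnS leq_eqVlt => /orP[/eqP kj|kj].
  by subst j; rewrite descend_id descendS // descend_id.
by rewrite !descendS //; [exact: IH | exact: ltnW].
Qed.

Lemma continuous_descend k j : continuous (@descend k j).
Proof.
elim: j => [|j IH] /=; case: pselect => [e|_].
- by case: k / e; move=> x; exact: cvg_id.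
- exact: cst_continuous.
- by case: k / e {IH}; move=> x; exact: cvg_id.
- exact: continuous_compose (bondPL P j).1 IH.
Qed.

Lemma continuous_from_pretelescope (X : topologicalType)
    (g : pretelescope P -> X) :
  (forall i, continuous (fun u : piece P i => g (existT (piece P) i u))) ->
  continuous g.
Proof.
move=> cg; have := @sigT_continuous nat (piece P) X _ cg.
set h := (h in continuous h -> _); suff -> : h = g by [].
by apply: funext => -[].
Qed.

Lemma continuous_level : continuous (@level R P).
Proof.
apply: (@tele_lift_continuous R P R (@prelevel R P)).
  by move=> _ _ [i x t s ts ss]; rewrite /prelevel /= ts ss.
apply: continuous_from_pretelescope => i.
exact: continuous_compose (@continuous_snd _ _) (@continuous_set_val _ _).
Qed.

Lemma continuous_tele (Z : topologicalType) i (x : Z -> P i)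
    (t : Z -> segment (i.-1%:R : R) i%:R) : continuous x -> continuous t ->
  continuous (fun z => tele (x z) (t z)).
Proof.
move=> cx ct; have cp : continuous (\pi_(telescope P) : pretelescope P -> _).
  exact: pi_continuous.
exact: (continuous_compose (continuous_pair cx ct)
  (continuous_compose (@existT_continuous _ (piece P) i) cp)).
Qed.

Definition prescaled k (a : pretelescope P) : 'rV[R]_(pdim (P k)) :=
  Num.max 0 (prelevel a - k%:R + 1) *: val (descend k (projT2 a).1).

Definition rho k (z : telescope P) : P k := descend k (projT2 (repr z)).1.

(* Unlike [rho], which is only meaningful above level [k - 1], the rescaled
   map is continuous on the whole telescope. *)
Definition scaled_rho k (z : telescope P) : 'rV[R]_(pdim (P k)) :=
  Num.max 0 (level z - k%:R + 1) *: val (rho k z).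

(** If [k <= i], the bonding maps match the two representatives of a joint at level [i]. Otherwise
    [i <= k - 1], and the vanishing factor hides the junk value. *)
Lemma prescaled_glue k a b : Defs.glue a b -> prescaled k a = prescaled k b.
Proof.
case=> i x t s ts ss; rewrite /prescaled /prelevel /= ts ss.
have [ki|ik] := leqP k i; first by rewrite -descendS.
by rewrite (max_idPl _) ?scale0r //; move: ik; rewrite -(ler_nat R) -natr1; lra.
Qed.

Lemma continuous_scaled_rho k : continuous (scaled_rho k).
Proof.
apply: (@tele_lift_continuous R P _ (prescaled k)); first exact: prescaled_glue.
apply: continuous_from_pretelescope => i; rewrite /prescaled /prelevel /=.
apply: (continuous_scale (a := fun u : piece P i => Num.max 0 (val u.2 - k%:R +
  1))).
  have c2 : continuous (fun u : piece P i => val u.2).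
    exact: continuous_compose (@continuous_snd _ _) (@continuous_set_val _ _).
  move=> u; apply: (@continuous_max _ _ (fun=> 0)
    (fun u : piece P i => val u.2 - k%:R + 1)); first exact: cvg_cst.
  by apply: cvgD; [apply: cvgB; [exact: c2 | exact: cvg_cst] | exact: cvg_cst].
exact: (continuous_compose (@continuous_fst _ _)
  (continuous_compose (@continuous_descend k i) (@continuous_set_val _ _))).
Qed.

Lemma scaled_rho_tele k j (x : P j) (t : segment (j.-1%:R : R) j%:R) :
  scaled_rho k (tele x t) = Num.max 0 (val t - k%:R + 1) *: val (descend k x).
Proof. exact: (tele_lift (@prescaled_glue k)). Qed.

(** Above level [k - 1] the scaling factor is positive and can be cancelled, so [rho] does not
    depend on the representative there. *)
Lemma rho_tele k j (x : P j) (t : segment (j.-1%:R : R) j%:R) :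
  k%:R - 1 < val t -> rho k (tele x t) = descend k x.
Proof.
move=> /= kt; have := scaled_rho_tele k x t.
rewrite /scaled_rho level_pi /prelevel /= => /scalerI e.
by apply/val_inj/e; rewrite gt_eqF // lt_max; apply/orP; right; lra.
Qed.

Lemma level_ge0 (z : telescope P) : 0 <= level z.
Proof.
rewrite /level /prelevel; have /andP[+ _] := segmentP (projT2 (repr z)).2.
exact: le_trans.
Qed.

Lemma tele_clamp j (x : P j) (t : segment (j.-1%:R : R) j%:R) :
  tele x t = tele x (clamp (pred_natr_le R j) (val t)).
Proof. by congr tele; apply: val_inj; rewrite clampE //; exact: segmentP. Qed.

Lemma bond_rho k z : k%:R < level z -> bond (rho k.+1 z) = rho k z.
Proof.
rewrite /rho /level /prelevel => kz; apply: bond_descend.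
by rewrite -(ltr_nat R); apply: lt_le_trans kz _;
  case/andP: (segmentP (projT2 (repr z)).2).
Qed.

Lemma tele_glue j (x : P j.+1) (t : R) : t = j%:R ->
  tele x (clamp (pred_natr_le R j.+1) t) =
  tele (bond x) (clamp (pred_natr_le R j) t).
Proof.
move=> ->; apply/glue_pi/Glue.
  by rewrite clampE // lexx ler_nat leqnSn.
by rewrite clampE // lexx ler_nat leq_pred.
Qed.

Lemma tele_normal_form m (z : telescope P) : m%:R - 1 < level z <= m%:R ->
  z = tele (rho m z) (clamp (pred_natr_le R m) (level z)).
Proof.
move=> mz; have zE : z = \pi_(telescope P) (repr z) by rewrite reprK.
case: (repr z) zE => j [x t] zE; have {}zE : z = tele x t by [].
have tE : level z = val t by rewrite zE level_pi.
have lz := level_ge0 z.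
have /(piece_index_near lz) : j.-1%:R <= level z <= j%:R.
  by rewrite tE; exact: segmentP.
rewrite (piece_index_eq lz mz) => -[mj|[n [jn zn mn]]].
  by subst j; rewrite {2}zE rho_tele ?descend_id ?tE -?tele_clamp //; lra.
(* The chosen representative may lie at the lower end of the next piece; one bonding map then brings
   it to [P m]. *)
subst j n; rewrite {2}zE rho_tele; last by rewrite -tE; lra.
by rewrite descendS // descend_id -tele_glue // tE -tele_clamp.
Qed.

Lemma tele_eq m (y z : telescope P) : level y = level z ->
  m%:R - 1 < level z <= m%:R -> rho m y = rho m z -> y = z.
Proof.
move=> yz mz r; rewrite (tele_normal_form mz) (@tele_normal_form m y) ?yz //.
by rewrite r.
Qed.

Lemma telescope_compact N :
  exists2 C : set (telescope P), compact C & forall z, level z <= N%:R -> C z.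
Proof.
pose e i (u : piece P i) := tele u.1 u.2.
exists (\big[setU/set0]_(i < N.+1) (@e i @` [set: piece P i])).
  apply: bigsetU_compact => i _; apply: continuous_compact.
    apply: continuous_subspaceT; apply: continuous_tele.
      exact: continuous_fst.
    exact: continuous_snd.
  rewrite -setXTT; apply: compact_setX; first exact: polyhedron_compact.
  apply: compact_set_type.
  have -> : segment (i.-1%:R : R) i%:R = `[i.-1%:R, i%:R]%classic.
    by apply/seteqP; split=> t; rewrite /segment /= in_itv.
  exact: segment_compact.
move=> z zN; rewrite -(bigcup_mkord N.+1 (fun i => @e i @` [set: piece P i])).
have mz := piece_index_itv (level_ge0 z).
set m := piece_index _ in mz; exists m => /=.
  by rewrite ltnS; case/andP: mz => mz _; exact: leq_of_natr_bounds mz zN.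
exists (rho m z, clamp (pred_natr_le R m) (level z)) => //.
by rewrite /e /= -tele_normal_form.
Qed.

(* The compact part of the telescope below a given level embeds into Euclidean
   spaces through the level and the rescaled maps. *)
Lemma tele_continuous_at (Z : topologicalType) (f : Z -> telescope P) m z :
  m%:R - 1 < level (f z) <= m%:R ->
  {for z, continuous (fun y => level (f y))} ->
  {for z, continuous (fun y => scaled_rho m (f y))} ->
  {for z, continuous f}.
Proof.
move=> mz cl cs; pose G y := (level y, scaled_rho m y).
have cG : continuous G.
  exact: continuous_pair continuous_level (@continuous_scaled_rho m).
have cGf : {for z, continuous (G \o f)} by exact: (cvg_pair cl cs).
have [C cC CP] := telescope_compact m.+1.
move=> U; rewrite nbhsE => -[V [oV Vz] VU].
(* The compact image of [C] minus [V] misses [G (f z)], because [G] separates [f z] from all other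
   points. For [y] near [z] the level keeps [f y] in [C], so [f y] must be in [V]. *)
have clG : closed (G @` (C `&` ~` V)).
  apply: compact_closed.
    exact: (@norm_hausdorff R (R^o * 'rV[R]_(pdim (P m)))%type).
  apply: continuous_compact; first exact: continuous_subspaceT.
  by apply: compact_closedI => //; exact: open_closedC.
have nG : ~ (G @` (C `&` ~` V)) (G (f z)).
  move=> [y [_ nVy] [yz]]; rewrite /scaled_rho yz => /scalerI ry; apply: nVy.
  have -> // : y = f z; apply: (tele_eq yz mz); apply/val_inj/ry.
  by rewrite gt_eqF // lt_max; apply/orP; right; lra.
have near1 : \forall y \near z, ~ (G @` (C `&` ~` V)) (G (f y)).
  apply: (cGf (~` (G @` (C `&` ~` V)))).
  by apply: open_nbhs_nbhs; split => //; exact: closed_openC.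
have near2 : \forall y \near z, level (f y) < m.+1%:R.
  by apply: (cvgr_lt _ cl); rewrite -natr1; lra.
apply: filterS2 near1 near2 => y nGy ly; apply: VU; apply: contrapT => nVy.
by apply: nGy; exists (f y) => //; split => //; apply: CP; exact: ltW.
Qed.

End TelescopeTopology.

(** * Partial threads and a pigeonhole principle for ultrafilters *)

(** Put [d n] at place [n], fill the places below with its images and keep [d] above. *)
Lemma partial_threads (T : nat -> Type) (p : forall k, T k.+1 -> T k)
    (V : forall k, set (T k)) (d : forall k, T k) :
  (forall k, V k (d k)) -> (forall k x, V k.+1 x -> V k (p k x)) -> forall n,
  exists s : forall k, T k,
    (forall k, V k (s k)) /\ forall k, (k < n)%N -> s k = p k (s k.+1).
Proof.
move=> Vd Vp n.
suff [s [_ Vs ps]] : exists s : forall k, T k, [/\ s n = d n,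
    forall k, V k (s k) & forall k, (k < n)%N -> s k = p k (s k.+1)] by exists
      s.
elim: n (d n) (Vd n) => [|n IH] x Vx.
  exists (@dfwith nat T d 0%N x); split=> //; first exact: dfwithin.
  by move=> k; case: dfwithP.
have [s [sn Vs ps]] := IH (p n x) (Vp n x Vx).
exists (@dfwith nat T s n.+1 x); split; first exact: dfwithin.
  by move=> k; case: dfwithP.
move=> k; rewrite ltnS leq_eqVlt => /orP[/eqP ->|kn].
  by rewrite dfwithin dfwithout ?gtn_eqF.
rewrite dfwithout; last by rewrite gtn_eqF // ltnW.
by rewrite dfwithout; [exact: ps | rewrite gtn_eqF].
Qed.

(** An ultrafilter that contains a finite union contains one of its members. *)
Lemma ultra_pigeonhole (T : Type) (A : eqType) (U : set_system T) (r : seq A)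
    (rel : A -> set T) : UltraFilter U ->
  U [set n | exists2 a, a \in r & rel a n] -> exists a, U (rel a).
Proof.
move=> UU; elim: r => [|a r IH] Ur.
  by have [n [a]] := filter_ex Ur.
have [Ua|Ua] := in_ultra_setVsetC (rel a) UU; first by exists a.
apply: IH; apply: filterS2 Ur Ua => n [a']; rewrite inE => /predU1P[->//|a'r]
  na' _.
by exists a'.
Qed.

(** * Points of the inverse limit and path components of its levels *)

Section InverseLimit.
Variables (R : realType) (X : topologicalType) (A : presentation R X).

Lemma continuous_coord i : continuous (Defs.coord A i).
Proof.
have c : continuous (fun x : X => val (pres_map A x)).
  exact: continuous_compose (pres_homeo A).1 (@continuous_set_val _ _).
exact: (continuous_compose c (@proj_continuous nat (fun k => A k :
  topologicalType) i)).
Qed.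

Lemma coord_surj (z : forall k, A k) :
  (forall k, bond (z k.+1) = z k) -> exists x : X, forall k, Defs.coord A k x =
    z k.
Proof.
move=> zP; have [_ [g [_ _ gK]]] := pres_homeo A.
pose z' : @invlim R A := exist (fun s => s \in @invlim R A) z (mem_set zP).
by exists (g z') => k; rewrite /Defs.coord gK.
Qed.

Lemma closed_polyhedron_eq (T : topologicalType) (S : polyhedron R) (f g : T ->
  S) :
  continuous f -> continuous g -> closed [set x | f x = g x].
Proof.
move=> cf cg.
have c : continuous (fun x => val (f x) - val (g x)).
  move=> x; apply: (@cvgB _ _ _ _ _ (fun x => val (f x)) (fun x => val (g x))).
    exact: (continuous_compose cf (@continuous_set_val _ _)).
  exact: (continuous_compose cg (@continuous_set_val _ _)).
have -> : [set x | f x = g x] =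
    (fun x => val (f x) - val (g x)) @^-1` [set 0].
  apply/seteqP; split=> x /=; first by move=> ->; rewrite subrr.
  by move=> /subr0_eq; exact: val_inj.
apply: preimage_closed; first by move=> x _; exact: c.
by apply: compact_closed; [exact: norm_hausdorff | exact: compact_set1].
Qed.

(** Partial threads cluster in the compact product of the [D k]. The relation between places [k] and
    [k + 1] is closed and holds for all but finitely many of them, so it passes to the cluster
    point. *)
Lemma compact_thread (D : forall k, set (A k)) :
  (forall k, closed (D k)) -> (forall k, D k !=set0) ->
  (forall k x, D k.+1 x -> D k (bond x)) ->
  exists x : X, forall k, D k (Defs.coord A k x).
Proof.
move=> clD D0 Dbond; pose d k := projT1 (cid (D0 k)).
have dD k : D k (d k) := projT2 (cid (D0 k)).
pose S_ n := cid (partial_threads (p := fun k => @bond R A k) dD Dbond n).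
pose s n : prod_topology (fun k => A k) := projT1 (S_ n).
have [sD sb] : (forall n k, D k (s n k)) /\
    forall n k, (k < n)%N -> s n k = bond (s n k.+1).
  by split=> n; have [] := projT2 (S_ n).
have cD : compact [set z : prod_topology (fun k => A k) | forall k, D k (z k)].
  apply: (@tychonoff _ (fun k => A k : topologicalType)) => k.
  by apply: (subclosed_compact (clD k) (@polyhedron_compact R (A k))).
have [z [/= zD zs]] : [set z : prod_topology (fun k => A k) | forall k, D k (z
  k)]
    `&` cluster (s @ \oo) !=set0.
  by apply: cD; exists 0%N => // n _; exact: sD.
have [|x xz] := @coord_surj z; last by exists x => k; rewrite xz.
move=> k; pose E := [set y : prod_topology (fun k => A k) | bond (y k.+1) = y
  k].
suff : E z by [].
have clE : closed E.
  apply: closed_polyhedron_eq; last exact: (@proj_continuous nat (fun k => A k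
    : topologicalType) k).
  apply: (@continuous_compose _ _ _ (fun y : prod_topology (fun k => A k) => y
    k.+1)
    (@bond R A k)); last exact: (bondPL A k).1.
  exact: (@proj_continuous nat (fun k => A k : topologicalType) k.+1).
apply: clE => W zW; apply: zs => //.
by exists k.+1 => // n /= kn; rewrite /E /= -sb.
Qed.

(** The path components [D k] of the [y k] form an inverse system of closed sets, so some [x'] has
    all its coordinates in them. The preimage of [D k] in [X] is clopen, since both [D k] and its
    complement are unions of path components, and it contains [x']. *)
Lemma connected_coord_joined (x : X) (y : forall k, A k) :
  connected [set: X] -> (forall k, joined R (bond (y k.+1)) (y k)) ->
  forall k, joined R (Defs.coord A k x) (y k).
Proof.
move=> cX yb; pose D k := [set u : A k | joined R u (y k)].
have clD k : closed (D k).
  apply: joined_closed => u u' Du uu'.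
  by apply: joined_trans Du; exact: joined_sym.
have [x' x'D] : exists x', forall k, D k (Defs.coord A k x').
  apply: compact_thread => // [k|k u Du]; first by exists (y k);
    exact: joined_refl.
  by apply: joined_trans (yb k); apply: joined_map Du; exact: (bondPL A k).1.
move=> k; suff /seteqP[_] : Defs.coord A k @^-1` D k = [set: X] by apply.
apply: cX.
- by exists x'; exact: x'D.
- exists (Defs.coord A k @^-1` D k); last by rewrite setTI.
  apply: open_comp; first by move=> u _; exact: continuous_coord.
  rewrite -closedC; apply: joined_closed => u u' nDu uu' Du'; apply: nDu.
  exact: joined_trans uu' Du'.
- exists (Defs.coord A k @^-1` D k); last by rewrite setTI.
  by apply: preimage_closed => // u _; exact: continuous_coord.
Qed.

End InverseLimit.

(** * Homotopy fibres over the traces and paths in them *)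

Section HomotopyFibre.
Variables (R : realType) (P Q : inv_seq R) (w : level_map P Q).
Variables (q0 : forall k, Q k) (v : level_path Q).

(** Keeps interpolated times inside the domain of a trace. *)
Lemma convex_gt (u c x y : R) :
  0 <= u <= 1 -> c < x -> c < y -> c < x + u * (y - x).
Proof.
move=> /andP[u0 u1] cx cy; have [xy|/ltW yx] := leP x y.
  have : 0 <= u * (y - x) by rewrite mulr_ge0 ?subr_ge0.
  lra.
have : 0 <= (1 - u) * (x - y) by rewrite mulr_ge0 ?subr_ge0.
lra.
Qed.

Definition to_unit (t : R) : R := val (clamp ler01 t).

Lemma to_unit_itv t : 0 <= to_unit t <= 1.
Proof. exact: segmentP. Qed.

Lemma to_unitE t : 0 <= t <= 1 -> to_unit t = t.
Proof. exact: clampE. Qed.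

Lemma to_unit0 : to_unit 0 = 0.
Proof. by rewrite to_unitE // lexx ler01. Qed.

Lemma to_unit1 : to_unit 1 = 1.
Proof. by rewrite to_unitE // lexx ler01. Qed.

Lemma continuous_to_unit : continuous to_unit.
Proof.
exact: continuous_compose (@continuous_clamp _ _ _ _) (@continuous_set_val _ _).
Qed.


Lemma to_halfline_subproof (t : R) : Num.max 0 t \in halfline R.
Proof. by apply/mem_set; rewrite /halfline /= le_max lexx. Qed.

(** Negative times go to 0, so that the trace at level 0 also makes sense after time -1 and the
    bound [k - 1] is uniform in [k]. *)
Definition to_halfline (t : R) : halfline R :=
  exist (fun s => s \in halfline R) _ (to_halfline_subproof t).

Lemma to_halfline_val (t : halfline R) : to_halfline (val t) = t.
Proof. by apply: val_inj => /=; apply/max_idPr; exact: halflineP. Qed.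

Lemma continuous_to_halfline : continuous to_halfline.
Proof.
apply: continuous_to_set_type => t /=.
by apply: (@continuous_max _ _ (fun=> 0) id); [exact: cvg_cst | exact: cvg_id].
Qed.

(* The push-forward to [Q k] of the level path [v], defined after time [k - 1]. *)
Definition trace k (t : R) : Q k := rho q0 k (v (to_halfline t)).

Lemma level_to_halfline t : level (v (to_halfline t)) = Num.max 0 t.
Proof. by rewrite lpath_level. Qed.

(** After time [k - 1] the factor of [scaled_rho] can be divided out; this is how the trace inherits
    continuity. *)
Lemma trace_scaled k t : k%:R - 1 < t ->
  val (trace k t) = (Num.max 0 t - k%:R + 1)^-1 *: scaled_rho q0 k (v
    (to_halfline t)).
Proof.
move=> kt; rewrite /scaled_rho level_to_halfline.
have m0 : 0 < Num.max 0 t - k%:R + 1.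
  by have : t <= Num.max 0 t; [rewrite le_max lexx orbT | lra].
by rewrite (max_idPr (ltW m0)) scalerA mulVf ?scale1r // gt_eqF.
Qed.

Lemma bond_trace k t : k%:R < t -> bond (trace k.+1 t) = trace k t.
Proof.
move=> kt; apply: bond_rho; rewrite level_to_halfline.
by rewrite lt_max kt orbT.
Qed.

Lemma bonds_trace n k (t : R) : (n + k)%:R - 1 < t ->
  @bonds R Q n k (trace (n + k) t) = trace k t.
Proof.
elim: n => // n IH nt; rewrite addSn -natr1 addrK in nt; rewrite /=.
by rewrite bond_trace // IH //; lra.
Qed.

Lemma continuous_trace (Z : topologicalType) (g : Z -> R) k :
  continuous g -> (forall z, k%:R - 1 < g z) -> continuous (fun z => trace k (g
    z)).
Proof.
move=> cg kg; apply: continuous_to_set_type.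
under eq_fun do rewrite trace_scaled //.
apply: continuous_scale.
  have cm : continuous (fun z => Num.max 0 (g z) - k%:R + 1).
    move=> z; apply: cvgD; last exact: cvg_cst.
    apply: cvgB; last exact: cvg_cst.
    by apply: (@continuous_max _ _ (fun=> 0) g); [exact: cvg_cst | exact: cg].
  move=> z; apply: (@cvgV _ _ _ _ (fun z => Num.max 0 (g z) - k%:R + 1)).
    by rewrite gt_eqF //; have := kg z; case: (lerP 0 (g z)); lra.
  exact: cm.
exact: (continuous_compose (continuous_compose cg continuous_to_halfline)
  (continuous_compose (@lpath_cont _ _ v) (@continuous_scaled_rho _ _ q0 k))).
Qed.

(* A point of the homotopy fibre of [w k] over the trace of [v]. *)
Record state k := State { st_time : R; st_pt : P k; st_path : R -> Q k }.

Definition valid k (e : state k) :=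
  [/\ k%:R - 1 < st_time e, continuous (st_path e),
      st_path e 0 = w k (st_pt e) & st_path e 1 = trace k (st_time e)].

Definition bond_state k (e : state k.+1) : state k :=
  State (st_time e) (bond (st_pt e)) (fun s => bond (st_path e s)).

Definition bonds_state n k (e : state (n + k)) : state k :=
  State (st_time e) (@bonds R P n k (st_pt e)) (fun s => @bonds R Q n k
    (st_path e s)).

Lemma continuous_bond (S : inv_seq R) k : continuous (@bond R S k).
Proof. exact: (bondPL S k).1. Qed.

Lemma continuous_bonds (S : inv_seq R) n k : continuous (@bonds R S n k).
Proof.
elim: n => [|n IH] /=; first by move=> x; exact: cvg_id.
exact: continuous_compose (@continuous_bond _ _) IH.
Qed.

Lemma valid_bond k (e : state k.+1) : valid e -> valid (bond_state e).
Proof.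
move=> [te ce e0 e1]; rewrite -natr1 addrK in te; split => /=.
- lra.
- exact: continuous_compose ce (@continuous_bond _ _).
- by rewrite e0 lmap_bond.
- by rewrite e1 bond_trace.
Qed.

Lemma valid_bonds n k (e : state (n + k)) : valid e -> valid (bonds_state e).
Proof.
elim: n e => [|n IH] e ve; first by case: e ve.
exact: (IH (bond_state e) (valid_bond ve)).
Qed.

(** A path in the homotopy fibre: [beta] moves the point, [theta] the time, and [Gamma] is the
    homotopy of the connecting paths. The identities are required on the unit square only. *)
Definition linked k (e e' : state k) := exists beta theta Gamma,
  [/\ [/\ continuous (beta : R -> P k), continuous (theta : R -> R),
        continuous (Gamma : R * R -> Q k)
        & forall a, 0 <= a <= 1 -> k%:R - 1 < theta a],
      [/\ beta 0 = st_pt e, beta 1 = st_pt e',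
          theta 0 = st_time e & theta 1 = st_time e'],
      forall a, 0 <= a <= 1 ->
        Gamma (a, 0) = w k (beta a) /\ Gamma (a, 1) = trace k (theta a)
    & forall s, 0 <= s <= 1 ->
        Gamma (0, s) = st_path e s /\ Gamma (1, s) = st_path e' s].

Lemma linked_sym k (e e' : state k) : linked e e' -> linked e' e.
Proof.
move=> [beta [theta [Gamma [[cb ct cG kt] [b0 b1 t0 t1] Gw Ge]]]].
pose r (a : R) := -1 * a + 1.
have cr : continuous r := @continuous_affine _ _ _.
have r01 a : 0 <= a <= 1 -> 0 <= r a <= 1 by rewrite /r; lra.
have [r0 r1] : r 0 = 1 /\ r 1 = 0 by rewrite /r; split; ring.
exists (beta \o r), (theta \o r), (fun z => Gamma (r z.1, z.2)); split.
- split.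
  + exact: continuous_compose cr cb.
  + exact: continuous_compose cr ct.
  + apply: (continuous_compose (continuous_pair _ (@continuous_snd _ _)) cG).
    exact: (continuous_compose (@continuous_fst _ _) cr).
  + by move=> a /r01/kt.
- by rewrite /= r0 r1.
- by move=> a /r01/Gw.
- by move=> s /Ge[? ?]; rewrite /= r0 r1.
Qed.

Lemma linked_trans k (e' e e'' : state k) :
  linked e e' -> linked e' e'' -> linked e e''.
Proof.
move=> [beta [theta [Gamma [[cb ct cG kt] [b0 b1 t0 t1] Gw Ge]]]].
move=> [beta' [theta' [Gamma' [[cb' ct' cG' kt'] [b0' b1' t0' t1'] Gw' Ge']]]].
pose r (a : R) := 2 * a + 0; pose r' (a : R) := 2 * a + -1.
have cr : continuous r := @continuous_affine _ _ _.
have cr' : continuous r' := @continuous_affine _ _ _.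
have r_half : r 2^-1 = 1 by rewrite /r; lra.
have r'_half : r' 2^-1 = 0 by rewrite /r'; lra.
have [r0 r'1] : r 0 = 0 /\ r' 1 = 1 by rewrite /r /r'; split; ring.
have rI a : 0 <= a -> a <= 2^-1 -> 0 <= r a <= 1 by rewrite /r; lra.
have r'I a : 2^-1 < a -> a <= 1 -> 0 <= r' a <= 1 by rewrite /r'; lra.
have half0 : (0 <= 2^-1 :> R) = true by lra.
have half1 : (1 <= 2^-1 :> R) = false by lra.
exists (fun a => if a <= 2^-1 then beta (r a) else beta' (r' a)).
exists (fun a => if a <= 2^-1 then theta (r a) else theta' (r' a)).
(* The second coordinate is clamped because the two squares are known to agree along their common
   edge only for [s] in the unit interval. *)
exists (fun z => if z.1 <= 2^-1 then Gamma (r z.1, to_unit z.2)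
                 else Gamma' (r' z.1, to_unit z.2)).
split.
- split.
  + apply: (@continuous_if_le R _ _ id).
    * by move=> t; exact: cvg_id.
    * exact: continuous_compose cr cb.
    * exact: continuous_compose cr' cb'.
    * by move=> a ->; rewrite r_half r'_half b1 b0'.
  + apply: (@continuous_if_le R _ _ id).
    * by move=> t; exact: cvg_id.
    * exact: continuous_compose cr ct.
    * exact: continuous_compose cr' ct'.
    * by move=> a ->; rewrite r_half r'_half t1 t0'.
  + have cp (q : R -> R) : continuous q ->
        continuous (fun z : R * R => (q z.1, to_unit z.2)).
      move=> cq; apply: continuous_pair.
        exact: (continuous_compose (@continuous_fst _ _) cq).
      exact: (continuous_compose (@continuous_snd _ _) continuous_to_unit).
    apply: (@continuous_if_le R _ _ fst).
    * exact: continuous_fst.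
    * exact: (continuous_compose (cp _ cr) cG).
    * exact: (continuous_compose (cp _ cr') cG').
    * move=> [a s] /= ->; rewrite r_half r'_half.
      by rewrite (Ge _ (to_unit_itv s)).2 (Ge' _ (to_unit_itv s)).1.
  + move=> a /andP[a0 a1]; case: ifPn => [ah|]; first exact/kt/rI.
    by rewrite -ltNge => ah; exact/kt'/r'I.
- by rewrite half0 half1 r0 r'1.
- move=> a /andP[a0 a1] /=; rewrite to_unit0 to_unit1.
  by case: (leP a) => ah; [exact/Gw/rI | exact/Gw'/r'I].
- move=> s s01 /=; rewrite half0 half1 r0 r'1 to_unitE //.
  by rewrite (Ge _ s01).1 (Ge' _ s01).2.
Qed.

Lemma linked_bond k (e e' : state k.+1) :
  linked e e' -> linked (bond_state e) (bond_state e').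
Proof.
move=> [beta [theta [Gamma [[cb ct cG kt] [b0 b1 t0 t1] Gw Ge]]]].
exists (fun a => bond (beta a)), theta, (fun z => bond (Gamma z)); split=> //.
- split=> //.
  + exact: continuous_compose cb (@continuous_bond _ _).
  + exact: continuous_compose cG (@continuous_bond _ _).
  + by move=> a /kt; rewrite -natr1; lra.
- by rewrite b0 b1.
- move=> a a01; have [-> ->] := Gw a a01; rewrite lmap_bond bond_trace //.
  by have := kt a a01; rewrite -natr1; lra.
- by move=> s /Ge[-> ->].
Qed.

Lemma linked_bonds n k (e e' : state (n + k)) :
  linked e e' -> linked (bonds_state e) (bonds_state e').
Proof.
elim: n e e' => [|n IH] e e' ee'; first by case: e e' ee' => ? ? ? [].
exact: (IH _ _ (linked_bond ee')).
Qed.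

(** The point stays fixed while the path is prolonged along the trace; thus states can be brought to
    a common time. *)
Lemma linked_shift k (e : state k) (t : R) : valid e -> k%:R - 1 < t ->
  exists e', [/\ valid e', st_time e' = t & linked e e'].
Proof.
move=> [ke ce e0 e1] kt; pose tau a := st_time e + to_unit a * (t - st_time e).
have ktau a : k%:R - 1 < tau a by exact: (convex_gt (to_unit_itv a)).
have ctau : continuous tau.
  move=> a; apply: cvgD; first exact: cvg_cst.
  by apply: cvgM; [exact: continuous_to_unit | exact: cvg_cst].
pose D r := if r <= 1 then st_path e r else trace k (tau (r - 1)).
have tau0 : tau 0 = st_time e by rewrite /tau to_unit0 mul0r addr0.
have tau1 : tau 1 = t by rewrite /tau to_unit1 mul1r; ring.
have cD : continuous D.
  apply: (@continuous_if_le R _ _ id) => //; first by move=> r; exact: cvg_id.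
    apply: continuous_trace => //.
    apply: (continuous_compose _ ctau) => r.
    by apply: cvgB; [exact: cvg_id | exact: cvg_cst].
  by move=> r ->; rewrite subrr tau0 e1.
have D0 : D 0 = st_path e 0 by rewrite /D ler01.
have D1 a : 0 <= a <= 1 -> D (1 + a) = trace k (tau a).
  rewrite /D => a01; case: ifPn => [a1|_]; last by rewrite addrAC subrr add0r.
  by have -> : a = 0 by [lra]; rewrite addr0 tau0.
(* [D] is the old path followed by the trace. At stage [a] the new path runs through [D] from 0 to
   [1 + a], ending at the trace at time [tau a]. *)
pose Gamma (z : R * R) := D ((1 + to_unit z.1) * to_unit z.2).
have cG : continuous Gamma.
  apply: continuous_compose cD => z; apply: cvgM.
    apply: cvgD; first exact: cvg_cst.
    exact: (continuous_compose (@continuous_fst _ _) continuous_to_unit).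
  exact: (continuous_compose (@continuous_snd _ _) continuous_to_unit).
exists (State t (st_pt e) (fun s => Gamma (1, s))); split=> //.
  split=> //=.
  - apply: continuous_compose cG.
    by apply: continuous_pair; [exact: cst_continuous | move=> s;
      exact: cvg_id].
  - by rewrite /Gamma /= to_unit0 mulr0 D0.
  - rewrite /Gamma /= to_unit1 mulr1 D1 ?tau1 //; lra.
exists (fun=> st_pt e), tau, Gamma; split=> //.
- by split=> //; exact: cst_continuous.
- move=> a a01; rewrite /Gamma /= to_unit0 to_unit1 mulr0 mulr1 D0 e0.
  by rewrite D1 ?to_unit_itv // to_unitE.
- move=> s s01; split=> //; rewrite /Gamma /= to_unit0 addr0 mul1r to_unitE //.
  by rewrite /D; case/andP: s01 => _ ->.
Qed.

(** The clause of [homotopy_lifting] for the fixed levels [n + k] and [k]. *)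
Definition lifts_homotopies n k :=
  forall (K : polyhedron R) (h : (K * unitI R)%type -> Q (n + k)%N)
      (h0 : K -> P (n + k)%N),
    continuous h -> continuous h0 ->
    (forall x, w (n + k)%N (h0 x) = h (x, unitI0 R)) ->
    exists ht : (K * unitI R)%type -> P k,
      [/\ continuous ht, forall z, w k (ht z) = @bonds R Q n k (h z)
        & forall x, ht (x, unitI0 R) = @bonds R P n k (h0 x)].

Lemma path_lifting k n : lifts_homotopies n k ->
  forall (d : R -> Q (n + k)) (x : P (n + k)), continuous d ->
    d 0 = w (n + k) x ->
  exists beta : R -> P k, [/\ continuous beta, beta 0 = @bonds R P n k x
    & forall a, 0 <= a <= 1 -> w k (beta a) = @bonds R Q n k (d a)].
Proof.
move=> lift d x cd d0; pose K := point_polyhedron R.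
pose o : K := exist (fun z => z \in @pset _ K) 0 (mem_set (I : [set: 'rV[R]_0]
  0)).
have [||y|ht [cht htw ht0]] := lift K (fun z => d (val z.2)) (fun=> x).
- apply: continuous_compose cd.
  exact: (continuous_compose (@continuous_snd _ _) (@continuous_set_val _ _)).
- exact: cst_continuous.
- by rewrite -d0.
exists (fun a => ht (o, clamp ler01 a)); split.
- apply: continuous_compose cht; apply: continuous_pair.
    exact: cst_continuous.
  exact: continuous_clamp.
- apply: etrans (ht0 o); congr (ht (_, _)); apply: val_inj.
  by rewrite clampE ?lexx ?ler01.
- by move=> a a01; rewrite htw clampE.
Qed.

End HomotopyFibre.

(** * Finiteness of the bonding images and the limit thread *)

Section HomotopyFibreLimit.
Variables (R : realType) (P Q : inv_seq R) (w : level_map P Q).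
Variables (q0 : forall k, Q k) (v : level_path Q).

Let c k := @trace R Q q0 v k.
Let val_ k := @valid R P Q w q0 v k.
Let lk k := @linked R P Q w q0 v k.

(** A lift of the path of [e] carries the point along until the path is used up, which leaves a
    point of the strict fibre. *)
Lemma linked_fibre n k (e : state P Q (n + k)) :
  lifts_homotopies w n k -> val_ e ->
  exists x, w k x = c k (st_time e) /\
    lk (bonds_state e) (State (st_time e) x (fun=> c k (st_time e))).
Proof.
move=> lift ve; have [te _ _ _] := valid_bonds ve.
have [te' ce e0 e1] := ve.
have [beta [cb b0 bw]] := path_lifting lift ce e0.
have bc : @bonds R Q n k (st_path e 1) = c k (st_time e).
  by rewrite e1 bonds_trace.
exists (beta 1); split; first by rewrite bw // lexx ler01.
(* At stage [a] the path waits at parameter [a] and then runs on to 1; at stage 1 it is constant. *)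
pose m (z : R * R) := Num.max (to_unit z.1) (to_unit z.2).
have cm : continuous m.
  move=> z; apply: (@continuous_max _ _ (fun z : R * R => to_unit z.1)
    (fun z : R * R => to_unit z.2)).
    exact: (continuous_compose (@continuous_fst _ _) (@continuous_to_unit R)).
  exact: (continuous_compose (@continuous_snd _ _) (@continuous_to_unit R)).
have m0l a : 0 <= a <= 1 -> m (0, a) = a.
  by move=> a01; rewrite /m /= to_unit0 to_unitE //; apply: max_idPr;
    case/andP: a01.
have m0r a : 0 <= a <= 1 -> m (a, 0) = a.
  by move=> a01; rewrite /m /= to_unit0 to_unitE //; apply: max_idPl;
    case/andP: a01.
have m1l a : m (1, a) = 1.
  by rewrite /m /= to_unit1; apply: max_idPl; case/andP: (to_unit_itv a).
have m1r a : m (a, 1) = 1.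
  by rewrite /m /= to_unit1; apply: max_idPr; case/andP: (to_unit_itv a).
exists beta, (fun=> st_time e), (fun z => @bonds R Q n k (st_path e (m z))).
split.
- split=> //; first exact: cst_continuous.
  exact: (continuous_compose (continuous_compose cm ce) (@continuous_bonds _ _
    _ _)).
- by split.
- by move=> a a01; rewrite m0r // m1r bw.
- by move=> s s01; rewrite m0l // m1l.
Qed.

(** An affine map with equal values at two points is constant on the segment between them, so the
    square can be constant. *)
Lemma linked_simplex k (K : {fset {fset 'rV[R]_(pdim (P k))}})
    (s : {fset 'rV[R]_(pdim (P k))}) (t : R) (x y : P k) :
  triangulates K (P k) -> s \in K -> affine_on (conv_hull s) (w k) ->
  conv_hull s (val x) -> conv_hull s (val y) -> k%:R - 1 < t ->
  w k x = c k t -> w k y = c k t ->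
  lk (State t x (fun=> c k t)) (State t y (fun=> c k t)).
Proof.
move=> KP sK aff sx sy kt wx wy.
have [d [cd sd dE]] := simplex_segment KP sK sx sy.
exists d, (fun=> t), (fun=> c k t); split=> //.
- by split=> //; exact: cst_continuous.
- split=> //; apply: val_inj; rewrite dE ?lexx ?ler01 //=.
    by rewrite subr0 scale1r scale0r addr0.
  by rewrite subrr scale1r scale0r add0r.
- move=> a a01; split=> //; apply: val_inj.
  by rewrite (aff x y (d a) a sx sy a01 (dE a a01)) wx wy -scalerDl subrK
    scale1r.
Qed.

(* Fibres of the simplexwise affine map [w k] meet each simplex in a convex
   set, so they have finitely many path components. *)
Lemma bonds_state_finite n k : lifts_homotopies w n k ->
  exists (K : {fset {fset 'rV[R]_(pdim (P k))}})
    (rep : {fset 'rV[R]_(pdim (P k))} -> set (state P Q (n + k))),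
  (forall e, val_ e -> exists2 s, s \in K & rep s e) /\
  forall s e e', rep s e -> rep s e' -> lk (bonds_state e) (bonds_state e').
Proof.
move=> lift; have [_ [K [KP aff]]] := lmapPL w k.
(* All states are first moved to this common time, so that a single fibre of [w k], over [c k t], is
   involved. *)
pose t : R := (n + k)%:R.
have kt : k%:R - 1 < t.
  by have : k%:R <= t by [rewrite ler_nat leq_addl]; lra.
exists K, (fun s e => s \in K /\ exists x, [/\ conv_hull s (val x),
  w k x = c k t & lk (bonds_state e) (State t x (fun=> c k t))]); split.
  move=> e ve.
  have [|e' [ve' te' ee']] := @linked_shift _ _ _ _ _ _ _ _ t ve;
    first by rewrite /t; lra.
  have [x [wx lx]] := linked_fibre lift ve'; rewrite te' in wx lx.
  have [s sK sx] : support_of K (val x).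
    by case: KP => _ ->; exact: (set_mem (valP x)).
  exists s => //; split=> //; exists x; split=> //.
  exact: linked_trans (linked_bonds ee') lx.
move=> s e e' [sK [x [sx wx lx]]] [_ [y [sy wy ly]]].
apply: linked_trans lx _; apply: linked_trans (linked_sym ly).
exact: (linked_simplex KP sK (aff s sK)).
Qed.

Lemma linked_thread : homotopy_lifting w ->
  (forall k, exists e : state P Q k, val_ e) ->
  exists e : forall k, state P Q k,
    forall k, val_ (e k) /\ lk (e k) (bond_state (e k.+1)).
Proof.
move=> hlp ex; pose d k := projT1 (cid (ex k)).
have dV k : val_ (d k) := projT2 (cid (ex k)).
pose S_ n := cid (partial_threads (p := fun k => @bond_state R P Q k) dV
  (fun k e => @valid_bond R P Q w q0 v k e) n).
pose S n := projT1 (S_ n).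
have [SV Sb] : (forall n k, val_ (S n k)) /\
    forall n k, (k < n)%N -> S n k = bond_state (S n k.+1).
  by split=> n; have [] := projT2 (S_ n).
have Sbs n m k : (m + k <= n)%N -> S n k = bonds_state (S n (m + k)%N).
  elim: m k => [|m IH] k mk; first by case: (S n _).
  rewrite IH ?(leq_trans _ mk) ?leq_add2r //.
  by rewrite (Sb n (m + k)%N mk).
have [U [UU Uoo]] := ultraFilterLemma eventually_filter.
have Ularge k : U [set n | (k <= n)%N] by apply: Uoo; exists k.
(* For large [n], [S n k] comes from level [m.+1 + k], so up to links it takes finitely many values.
   The ultrafilter selects one of them, represented by some [S n0 k]. *)
have lim k : exists e, val_ e /\ U [set n | lk (S n k) e].
  have [m lift] := hlp k.
  have [K [rep [repK replk]]] := bonds_state_finite lift.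
  have [s Us] : exists s, U [set n | rep s (S n (m.+1 + k)%N)].
    apply: (ultra_pigeonhole (r := enum_fset K)).
    apply: filterS (Ularge 0%N) => n _ /=.
    exact: repK.
  have Us' : U ([set n | rep s (S n (m.+1 + k)%N)] `&` [set n | (m.+1 + k <=
    n)%N]).
    exact: filterI Us (Ularge _).
  have [n0 [rn0 kn0]] := filter_ex Us'.
  exists (S n0 k); split; first exact: SV.
  apply: filterS Us' => n [/= rn kn].
  rewrite (Sbs _ _ _ kn) (Sbs _ _ _ kn0); exact: replk rn rn0.
pose e k := projT1 (cid (lim k)).
have eP k : val_ (e k) /\ U [set n | lk (S n k) (e k)] := projT2 (cid (lim k)).
exists e => k; split; first exact: (eP k).1.
(* One [n] serves levels [k] and [k + 1] at once, and there the partial thread is exact. *)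
have [n [/= [lk0 lk1] kn]] :=
  filter_ex (filterI (filterI (eP k).2 (eP k.+1).2) (Ularge k.+1)).
apply: linked_trans (linked_sym lk0) _; rewrite (Sb n k kn).
exact: linked_bond.
Qed.

End HomotopyFibreLimit.

(** * Maps into the telescope assembled from maps into its levels *)

Section PiecewisePaths.
Variables (R : realType) (S : inv_seq R) (Z : topologicalType) (l : Z -> R).
Variable g : forall m, Z -> S m.
Hypotheses (l_ge0 : forall z, 0 <= l z) (l_cont : continuous l).
Hypothesis g_cont : forall m, continuous (@g m).
Hypothesis g_compat : forall m z, l z = m%:R -> g m z = bond (g m.+1 z).

Definition tele_pieces : Z -> telescope S :=
  glue_pieces l (fun m z => tele (g m z) (clamp (pred_natr_le R m) (l z))).

Lemma continuous_tele_pieces : continuous tele_pieces.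
Proof.
apply: continuous_glue_pieces => // [m|m z zm].
  apply: continuous_tele => //.
  exact: (continuous_compose l_cont (@continuous_clamp _ _ _ _)).
by rewrite (tele_glue (g m.+1 z)) // g_compat.
Qed.

Lemma level_tele_pieces z : level (tele_pieces z) = l z.
Proof.
rewrite /tele_pieces /glue_pieces level_pi /prelevel clampE //.
exact: ceil_bounds.
Qed.

End PiecewisePaths.

(** * Reparametrising a level path and pushing it down to its level *)

Section TraceHomotopy.
Variables (R : realType) (Q : inv_seq R) (q0 : forall k, Q k) (v : level_path
  Q).

Lemma descend_trace k j (t : R) : (k <= j)%N -> j%:R - 1 < t ->
  descend q0 k (trace q0 v j t) = trace q0 v k t.
Proof.
elim: j => [|j IH] kj jt.
  by move: kj; rewrite leqn0 => /eqP ->; rewrite descend_id.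
move: kj; rewrite leq_eqVlt => /orP[/eqP ->|kj]; first by rewrite descend_id.
rewrite -natr1 addrK in jt.
by rewrite descendS // bond_trace // IH //; lra.
Qed.

Variables (Z : topologicalType) (l phi : Z -> R).
Hypotheses (l_ge0 : forall z, 0 <= l z) (l_cont : continuous l).
Hypothesis phi_cont : continuous phi.
Hypothesis phi_gt : forall m z, m%:R - 1 < l z -> m%:R - 1 < phi z.

(* The map [z |-> v (phi z)] pushed down the telescope to level [l z]. *)
Definition push_down (z : Z) : telescope Q :=
  let m := piece_index (l z) in
  tele (trace q0 v m (phi z)) (clamp (pred_natr_le R m) (l z)).

Lemma level_push_down z : level (push_down z) = l z.
Proof.
rewrite /push_down level_pi /prelevel clampE //.
exact: ceil_bounds.
Qed.

(** The index in [push_down] jumps at the joints, but this formula for a fixed [m] does not mention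
    it, so it yields continuity across them. At levels up to [m - 1] both sides vanish. *)
Lemma scaled_rho_push_down m z : scaled_rho q0 m (push_down z) =
  (Num.max 0 (l z - m%:R + 1) / (Num.max 0 (phi z) - m%:R + 1)) *:
    scaled_rho q0 m (v (to_halfline (phi z))).
Proof.
rewrite /push_down scaled_rho_tele clampE; last exact: ceil_bounds.
have [zm|mz] := leP (l z) (m%:R - 1).
  by rewrite (max_idPl _) ?mul0r ?scale0r //; lra.
have /andP[lp lp'] := piece_index_itv (l_ge0 z).
rewrite descend_trace //; last exact: phi_gt.
  by rewrite trace_scaled ?scalerA //; exact: phi_gt.
exact: leq_of_natr_bounds mz lp'.
Qed.

Lemma continuous_push_down : continuous push_down.
Proof.
move=> z; have lz := piece_index_itv (l_ge0 z);
  set m := piece_index (l z) in lz.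
apply: (@tele_continuous_at R Q q0 Z push_down m z).
- by rewrite level_push_down.
- by rewrite (funext level_push_down : (fun y => level (push_down y)) = l);
    exact: l_cont.
rewrite (funext (scaled_rho_push_down m)).
have cm (h : Z -> R) : continuous h -> continuous (fun z => Num.max 0 (h z)).
  by move=> ch y; apply: (@continuous_max _ _ (fun=> 0) h);
    [exact: cvg_cst|exact: ch].
have cl (h : Z -> R) : continuous h -> continuous (fun z => h z - m%:R + 1).
  move=> ch y; apply: cvgD; last exact: cvg_cst.
  by apply: cvgB; [exact: ch | exact: cvg_cst].
apply: (@cvgZ _ _ _ _ _ (fun z => Num.max 0 (l z - m%:R + 1) /
    (Num.max 0 (phi z) - m%:R + 1))); last first.
  exact: (continuous_compose (continuous_compose phi_cont
    (@continuous_to_halfline R))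
    (continuous_compose (@lpath_cont _ _ v) (@continuous_scaled_rho _ _ q0 m))).
apply: cvgM; first exact: (cm _ (cl _ l_cont)).
apply: (@cvgV _ _ _ _ (fun z => Num.max 0 (phi z) - m%:R + 1)).
  (* The denominator has to be nonzero only at the point [z] from which [m] was chosen. *)
  have mphi : m%:R - 1 < phi z by apply: phi_gt; case/andP: lz.
  by rewrite gt_eqF //; have : phi z <= Num.max 0 (phi z);
    [rewrite le_max lexx orbT | lra].
exact: (cl _ (cm _ phi_cont)).
Qed.

End TraceHomotopy.

(** * From a thread of linked states to a lifted level path *)

Section Lift.
Variables (R : realType) (P Q : inv_seq R) (w : level_map P Q).
Variables (q0 : forall k, Q k) (v : level_path Q).

(* Along [m - 1 <= t <= m] the lift follows the path in [P m] linking the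
   [m]-th point of the thread to the image of the next one. *)
Lemma level_path_lift (e : forall k, state P Q k) :
  (forall k, linked w q0 v (e k) (bond_state (e k.+1))) ->
  exists u : level_path P, level_homotopic (Defs.path_map w u) v.
Proof.
move=> le.
pose b_ m := cid (le m); pose t_ m := cid (projT2 (b_ m)).
pose g_ m := cid (projT2 (t_ m)).
pose beta m : R -> P m := projT1 (b_ m).
pose theta m : R -> R := projT1 (t_ m).
pose Gamma m : R * R -> Q m := projT1 (g_ m).
have H m : [/\ [/\ continuous (beta m), continuous (theta m), continuous (Gamma
  m)
        & forall a, 0 <= a <= 1 -> m%:R - 1 < theta m a],
      [/\ beta m 0 = st_pt (e m), beta m 1 = bond (st_pt (e m.+1)),
          theta m 0 = st_time (e m) & theta m 1 = st_time (e m.+1)],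
      forall a, 0 <= a <= 1 ->
        Gamma m (a, 0) = w m (beta m a) /\ Gamma m (a, 1) = trace q0 v m (theta
          m a)
    & forall s, 0 <= s <= 1 ->
        Gamma m (0, s) = st_path (e m) s /\
        Gamma m (1, s) = bond (st_path (e m.+1) s)] := projT2 (g_ m).
(* Rescales [m - 1, m] to the unit interval. At time 0 the piece of index 0 is met only at its end,
   as [r 0 0 = 1]. *)
pose r m (t : R) := t - m%:R + 1.
have cr (Z : topologicalType) (l : Z -> R) m :
    continuous l -> continuous (fun z => r m (l z)).
  move=> cl z; apply: cvgD; last exact: cvg_cst.
  by apply: cvgB; [exact: cl | exact: cvg_cst].
have rm m : r m m%:R = 1 by rewrite /r; ring.
have rm1 m : r m.+1 m%:R = 0 by rewrite /r -(natr1 m); ring.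
have rI (t : R) : 0 <= t -> 0 <= r (piece_index t) t <= 1.
  by move=> t0; have := piece_index_itv t0; rewrite /r; lra.
pose Z := (halfline R * unitI R)%type; pose l (z : Z) : R := val z.1.
have lh_cont : continuous (fun t : halfline R => val t : R).
  exact: continuous_set_val.
have l_cont : continuous l.
  exact: (continuous_compose (@continuous_fst _ _) lh_cont).
have s_cont : continuous (fun z : Z => val z.2).
  exact: (continuous_compose (@continuous_snd _ _) (@continuous_set_val _ _)).
have lh_ge0 (t : halfline R) : 0 <= val t by exact: halflineP.
have l_ge0 (z : Z) : 0 <= l z by exact: halflineP.
pose gu m (t : halfline R) := beta m (r m (val t)).
have gu_cont m : continuous (gu m).
  by have [[cb _ _ _] _ _ _] := H m; exact: (continuous_compose (cr _ _ _
    lh_cont) cb).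
have gu_compat m (t : halfline R) : val t = m%:R -> gu m t = bond (gu m.+1 t).
  move=> tm; rewrite /gu tm rm rm1.
  by have [_ [_ -> _ _] _ _] := H m; have [_ [-> _ _ _] _ _] := H m.+1.
pose u := LevelPath (continuous_tele_pieces lh_ge0 lh_cont gu_cont gu_compat)
  (level_tele_pieces gu lh_ge0).
exists u.
pose gH m (z : Z) := Gamma m (r m (l z), val z.2).
have gH_cont m : continuous (gH m).
  have [[_ _ cG _] _ _ _] := H m.
  exact: (continuous_compose (continuous_pair (cr _ _ _ l_cont) s_cont) cG).
have gH_compat m (z : Z) : l z = m%:R -> gH m z = bond (gH m.+1 z).
  move=> zm; rewrite /gH zm rm rm1; have s01 := segmentP z.2.
  have [_ _ _ /(_ _ s01)[_ ->]] := H m.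
  by have [_ _ _ /(_ _ s01)[-> _]] := H m.+1.
(* The squares deform the image of [u] to a path [v1] whose value at [t] is [v] at a later or
   earlier time, pushed down to level [t]. *)
pose H1 := tele_pieces l gH.
have cH1 : continuous H1 by exact: continuous_tele_pieces.
have lH1 z : level (H1 z) = val z.1 by exact: level_tele_pieces.
pose v1 (t : halfline R) := H1 (t, unitI1 R).
have cv1 : continuous v1.
  apply: continuous_compose cH1; apply: continuous_pair;
    last exact: cst_continuous.
  by move=> t; exact: cvg_id.
pose v' := @LevelPath R Q v1 cv1 (fun t => lH1 (t, unitI1 R)).
apply: (@level_homotopic_trans R Q v').
  exists H1; split=> // t; rewrite /H1 /tele_pieces /glue_pieces /=
    /tele_pieces /glue_pieces.
  rewrite tele_map_pi; congr (\pi_(telescope Q) (existT (piece Q) _ (_, _))).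
  have [_ _ Gw _] := H (piece_index (val t)).
  by have [Gw0 _] := Gw _ (rI _ (lh_ge0 t)); exact: Gw0.
(* The times [theta m] glued together: [v1] at [t] is the trace of [v] at time [Theta t]. *)
pose Theta : halfline R -> R :=
  glue_pieces (fun t : halfline R => val t : R) (fun m t => theta m (r m (val
    t))).
have Theta_cont : continuous Theta.
  apply: continuous_glue_pieces => // [m|m t tm].
    have [[_ ct _ _] _ _ _] := H m.
    exact: (continuous_compose (cr _ _ _ lh_cont) ct).
  rewrite tm rm rm1.
  by have [_ [_ _ _ ->] _ _] := H m; have [_ [_ _ -> _] _ _] := H m.+1.
have Theta_gt m (t : halfline R) : m%:R - 1 < val t -> m%:R - 1 < Theta t.
  move=> mt; have /andP[_ ti] := piece_index_itv (lh_ge0 t).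
  have := leq_of_natr_bounds mt ti; rewrite -(ler_nat R) => mi.
  have [[_ _ _ /(_ _ (rI _ (lh_ge0 t))) th] _ _ _] := H (piece_index (val t)).
  by apply: le_lt_trans th; rewrite lerD2r.
apply: level_homotopic_sym.
(* Linear interpolation from [t] to [Theta t]; both exceed [m - 1] as soon as [t] does, so the
   traces stay defined and [v] is deformed to [v1]. *)
pose phi (z : Z) : R := l z + val z.2 * (Theta z.1 - l z).
have phi_cont : continuous phi.
  move=> z; apply: cvgD; first exact: l_cont.
  apply: cvgM; first exact: s_cont.
  apply: cvgB; last exact: l_cont.
  exact: (continuous_compose (@continuous_fst _ _) Theta_cont).
have phi_gt m z : m%:R - 1 < l z -> m%:R - 1 < phi z.
  by move=> mz; apply: convex_gt (segmentP z.2) mz (Theta_gt _ _ mz).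
exists (push_down q0 v l phi); split.
- exact: continuous_push_down.
- exact: level_push_down.
- move=> t; rewrite /push_down /phi /l /= mul0r addr0.
  have ti := piece_index_itv (lh_ge0 t).
  rewrite [RHS](@tele_normal_form R Q q0 (piece_index (val t))) lpath_level //.
  by rewrite /trace to_halfline_val.
- move=> t; rewrite /= /v1 /H1 /tele_pieces /glue_pieces /push_down /l /=.
  congr (tele _ _); rewrite /gH /l /=.
  have [_ _ Gw _] := H (piece_index (val t)).
  have [_ ->] := Gw _ (rI _ (lh_ge0 t)).
  by congr trace; rewrite /phi /l /= mul1r /Theta /glue_pieces addrC subrK.
Qed.

End Lift.

(** * Surjectivity on Steenrod homotopy sets *)

Theorem theorem3p15 (R : realType) (E B : metricType R)
    (compactE : compact [set: E]) (compactB : compact [set: B])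
    (f : E -> B) (contf : continuous f) (F : steenrod_fibration R f)
    (b : B) (bt : E) (btP : (f @^-1` [set b]) bt)
    (connectedB : connected [set: B]) :
  set_surj [set: pi0 (fib_dom F) bt] [set: pi0 (fib_cod F) b]
    (pi0_map (fib_map F) bt b).
Proof.
move=> c _; pose v := repr c; have cE : c = \pi_(pi0 (fib_cod F) b) v by
  rewrite reprK.
(* Supplies the default values of [descend]. *)
pose q0 k : fib_cod F k := Defs.coord (fib_cod F) k b.
have tr k : exists e, valid (fib_map F) q0 v (e : state (fib_dom F) (fib_cod F)
  k).
  (* The traces at times [k] form a thread up to paths. Connectedness of [B] then joins the
     coordinates of [b], which are the images of those of [bt], to them. *)
  have [m|d [cd d0 d1]] := @connected_coord_joined R B (fib_cod F) b
      (fun k => trace q0 v k k%:R) connectedB _ k.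
    rewrite bond_trace ?ltr_nat //.
    (* The trace at level [m], run backwards from time [m + 1] to time [m]. *)
    exists (fun a => trace q0 v m (m.+1%:R - to_unit a)); split.
    - apply: continuous_trace => [a|a].
        by apply: cvgB; [exact: cvg_cst | exact: continuous_to_unit].
      by have := to_unit_itv a; rewrite -natr1; lra.
    - by rewrite to_unit0 subr0.
    - by rewrite to_unit1 -natr1 addrK.
  exists (State k%:R (Defs.coord (fib_dom F) k bt) d); split=> //=; first lra.
  by rewrite d0 -fib_lim btP.
have [e eP] := linked_thread (fib_hlp F) tr.
have [u uv] := level_path_lift (fun k => (eP k).2).
exists (\pi_(pi0 (fib_dom F) bt) u) => //.
rewrite pi0_map_pi cE; apply/(@eqmodP _ (homotopy_equiv (fib_cod F)))/asboolP.
exact: uv.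
Qed.
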